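(* For every $\varepsilon>0$ there exists a constant $c=c(\varepsilon)>0$ such that the following holds. Let $p$ be a prime, let $I\subset\mathbb{F}_p\setminus\{0\}$ be an interval with $|I|<p^{3/46}$, and let $\lambda\in\mathbb{F}_p$ satisfy $\lambda\notin I^{-1}\cup\{0\}$. Then the number $J$ of solutions of $$x^{-1}+y^{-1}+z^{-1}=\lambda\quad\text{in }\mathbb{F}_p,\qquad x,y,z\in I,$$ satisfies $$J<c\,|I|^{2/3+\varepsilon}.$$
   Context: $\mathbb{F}_p$ is the field of residue classes modulo the prime $p$; $x^{-1}$ is the inverse in $\mathbb{F}_p$ and $I^{-1}=\{x^{-1}:x\in I\}$. An interval $I$ in $\mathbb{F}_p$ is a non-empty set of residue classes of consecutive integers $M+1,\dots,M+N$ with $1\le N\le p$, and $|I|=N$. *)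

(* Defs.v *)
From HB Require Import structures.
From mathcomp Require Import all_boot all_order all_algebra.
From mathcomp Require Import reals exp.

Set Implicit Arguments.
Unset Strict Implicit.
Unset Printing Implicit Defensive.

Import Order.TTheory GRing.Theory Num.Theory.

Local Open Scope ring_scope.

(* Here p is meant to be prime: for other p, 'F_p is not the ring of residue
   classes modulo p. *)
Definition is_interval (p : nat) (I : {set 'F_p}) : Prop :=
  exists (M : int) (N : nat),
    (1 <= N <= p)%N /\ I = [set ((M + i.+1%:Z)%:~R : 'F_p) | i : 'I_N].

Definition inverse_set (p : nat) (I : {set 'F_p}) : {set 'F_p} :=
  [set x^-1 | x in I].

(* MathComp has 0^-1 = 0, so this matches the intended count when 0 \notin I. *)
Definition num_solutions (p : nat) (I : {set 'F_p}) (lambda : 'F_p) : nat :=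
  #|[set t : 'F_p * 'F_p * 'F_p | let: (x, y, z) := t in
      [&& x \in I, y \in I, z \in I & x^-1 + y^-1 + z^-1 == lambda]]|.

(* Main.v *)
Require Import Defs.
From HB Require Import structures.
From mathcomp Require Import all_boot all_order all_algebra.
From mathcomp Require Import reals exp.
From mathcomp Require Import zify ring.

Set Implicit Arguments.
Unset Strict Implicit.
Unset Printing Implicit Defensive.

Import Order.TTheory GRing.Theory Num.Theory.

Local Open Scope ring_scope.

(* Write x = M + u with 0 <= u < N.  In terms of the elementary symmetric
   functions s1, s2, s3 of the shifts u, v, w, the equation becomes
   s3 + A s2 + B s1 + C = 0 in F_p, where T^3 + 3 A T^2 + 3 B T + C has the double
   root - M.  All determinants formed from the integer points (s1, s2, s3) being
   smaller than p, these points lie in one plane over the integers, while a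
   divisor argument puts only N^o(1) of them on any line.  If there are more than
   N^(2/3 + o(1)) points, then three non-collinear ones are so close together that
   the integer equation of the plane has a discriminant which is O(N^(46/3)),
   hence smaller than p; being 0 modulo p, it vanishes.  The double root is then
   a rational number - r / q, and with X = r + q u, etc., the solutions satisfy
   a X Y Z = b (X Y + X Z + Y Z) over the integers.
   The solutions with a given gcd (X, Y), or with given values of
   (u - v) / gcd (X, Y) and (u - w) / gcd (X, Z), are N^o(1) in number, again by
   counting divisors; taking the gcds below or above N^(2/3) gives the bound. *)

(** * Divisors and counting *)

(** A divisor is determined by its [q]-adic valuation and its part prime to [q]. *)
Lemma size_divisors_part (q n : nat) :
  prime q -> (0 < n)%N ->
  (size (divisors n) <= (logn q n).+1 * size (divisors n`_q^'))%N.
Proof.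
move=> q_pr n_gt0.
pose g (d : nat) := (logn q d, d`_q^')%N.
rewrite -(size_map g) -[X in (_ <= X * _)%N](size_iota 0) -(size_allpairs pair).
apply: uniq_leq_size.
  rewrite map_inj_in_uniq ?divisors_uniq // => d d'.
  rewrite -!dvdn_divisors // => dn d'n [El Em].
  have d_gt0 := dvdn_gt0 n_gt0 dn; have d'_gt0 := dvdn_gt0 n_gt0 d'n.
  by rewrite -[d](partnC q) // -[d' in RHS](partnC q) // !p_part El Em.
move=> _ /mapP [d dn ->]; rewrite -dvdn_divisors // in dn.
apply/allpairsP; exists (g d); split; last by [].
  by rewrite mem_iota add0n ltnS dvdn_leq_log.
by rewrite -dvdn_divisors ?part_gt0 // partn_dvd.
Qed.

(** Write [e + 1 <= k (e %/ k + 1) <= k 2 ^ (e %/ k)] and take [k]-th powers. This bounds the local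
    factor of the divisor function at small primes. *)
Lemma expSn_le_exp2 (k e : nat) : (0 < k)%N -> (e.+1 ^ k <= k ^ k * 2 ^ e)%N.
Proof.
move=> k_gt0.
have le1 : (e.+1 <= k * 2 ^ (e %/ k))%N.
  apply: (@leq_trans (k * (e %/ k).+1)); last by rewrite leq_mul2l ltn_expl ?orbT.
  by rewrite mulnC; apply: ltn_ceil.
apply: leq_trans (_ : (k * 2 ^ (e %/ k)) ^ k <= _)%N; first by rewrite leq_exp2r.
by rewrite expnMn -expnM leq_mul2l leq_exp2l // leq_divM orbT.
Qed.

(* The number of divisors is multiplicative; at a prime at least 2 ^ k the
   local factor is bounded by 1, at the other ones by k ^ k. *)
Lemma size_divisors_bound (k n : nat) : (0 < k)%N -> (0 < n)%N ->
  (size (divisors n) ^ k <= (k ^ k) ^ (2 ^ k) * n)%N.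
Proof.
move=> k_gt0 n_gt0; have kk_gt0 : (0 < k ^ k)%N by rewrite expn_gt0 k_gt0.
pose P q := (q < 2 ^ k)%N.
(* The exponent counts the prime divisors below [2 ^ k]; bounding it by [2 ^ k] only at the end lets
   the induction remove one prime at a time. *)
suff le1 : (size (divisors n) ^ k <= (k ^ k) ^ (count P (primes n)) * n)%N.
  apply: leq_trans le1 _; rewrite leq_mul2r leq_pexp2l ?orbT //.
  rewrite -size_filter -[leqRHS](size_iota 0); apply: uniq_leq_size.
    by rewrite filter_uniq ?primes_uniq.
  by move=> q; rewrite mem_filter mem_iota => /andP [].
elim/ltn_ind: n n_gt0 => n IHn n_gt0.
have [n_le1|n_gt1] := leqP n 1.
  have -> : n = 1%N by apply/eqP; rewrite eqn_leq n_le1.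
  by rewrite /= exp1n.
set q := pdiv n; have q_pr : prime q by apply: pdiv_prime.
have qn : q \in primes n by rewrite mem_primes q_pr n_gt0 pdiv_dvd.
set m := (n`_q^')%N.
have m_gt0 : (0 < m)%N by apply: part_gt0.
have En : (q ^ logn q n * m = n)%N by rewrite -p_part partnC.
have l_gt0 : (0 < logn q n)%N by rewrite logn_gt0.
have q_gt1 := prime_gt1 q_pr.
have lt_mn : (m < n)%N.
  by rewrite -[X in (_ < X)%N]En ltn_Pmull // -{1}(expn0 q) ltn_exp2l.
have Ec : count P (primes n) = (P q + count P (primes m))%N.
  rewrite (permP (perm_to_rem qn)) /= rem_filter ?primes_uniq // primes_part.
  by congr (_ + count _ _)%N; apply: eq_filter => x; rewrite !inE.
apply: leq_trans (_ : ((logn q n).+1 * size (divisors m)) ^ k <= _)%N.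
  by rewrite leq_exp2r // size_divisors_part.
rewrite expnMn Ec expnD -[X in (_ <= _ * X)%N]En mulnACA.
apply: leq_mul; last exact: IHn.
have [qk|qk] := boolP (P q).
  rewrite expn1; apply: leq_trans (expSn_le_exp2 _ k_gt0) _.
  by rewrite leq_mul2l leq_exp2r // q_gt1 orbT.
rewrite expn0 mul1n; rewrite /P -leqNgt in qk.
apply: leq_trans (_ : (2 ^ k) ^ logn q n <= _)%N; last by rewrite leq_exp2r.
by rewrite -expnM mulnC expnM leq_exp2r // ltn_expl.
Qed.

Definition zdivisors (z : int) : seq int :=
  [seq d%:Z | d <- divisors `|z|] ++ [seq - d%:Z | d <- divisors `|z|].

Lemma mem_zdivisors (d z : int) : z != 0 -> (d %| z)%Z -> d \in zdivisors z.
Proof.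
move=> z0 dz; have dz' : `|d|%N \in divisors `|z|.
  by rewrite -dvdn_divisors ?absz_gt0.
rewrite mem_cat; case: d dz dz' => n dz dz'; apply/orP; [left|right].
  by apply/mapP; exists n.
by apply/mapP; exists n.+1 => //; rewrite NegzE.
Qed.

Lemma size_zdivisors (z : int) : size (zdivisors z) = (size (divisors `|z|)).*2.
Proof. by rewrite size_cat !size_map addnn. Qed.

Lemma leq_card_fibers (U : finType) (V : eqType) (f : U -> V) (B : nat)
    (S : {set U}) (K : seq V) :
  {in S, forall s, f s \in K} ->
  {in K, forall k, (#|[set s in S | f s == k]| <= B)%N} ->
  (#|S| <= size K * B)%N.
Proof.
elim: K S => [|k K IHK] S SK fib.
  by rewrite leqn0 cards_eq0; apply/eqP/setP => s; rewrite inE; apply/idP => /SK.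
rewrite -(cardsID [set s | f s == k]) mulSn leq_add //.
  have -> : S :&: [set s | f s == k] = [set s in S | f s == k].
    by apply/setP => s; rewrite !inE.
  by apply: fib; rewrite mem_head.
apply: IHK => [s|j jK].
  by rewrite !inE => /andP [/negPf fsk /SK]; rewrite inE fsk.
apply: leq_trans (fib j _); last by rewrite inE jK orbT.
by apply/subset_leq_card/subsetP => s; rewrite !inE -andbA => /and3P [_ -> ->].
Qed.

Lemma large_fiber (U : finType) (V : eqType) (f : U -> V) (B : nat)
    (S : {set U}) (K : seq V) :
  {in S, forall s, f s \in K} -> (size K * B < #|S|)%N ->
  exists2 k, k \in K & (B < #|[set s in S | f s == k]|)%N.
Proof.
move=> SK lt; apply/hasP; apply: contraTT lt => /hasPn nK.
by rewrite -leqNgt; apply: leq_card_fibers SK _ => k /nK; rewrite -leqNgt.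
Qed.

Lemma absz_leM (A B : nat) (x y : int) :
  (`|x| <= A -> `|y| <= B -> `|(x * y)%R| <= A * B)%N.
Proof. by move=> xA yB; rewrite abszM leq_mul. Qed.

Lemma absz_leD (A B : nat) (x y : int) :
  (`|x| <= A -> `|y| <= B -> `|(x + y)%R| <= A + B)%N.
Proof. lia. Qed.

Lemma absz_leN (A : nat) (x : int) : (`|x| <= A -> `|(- x)%R| <= A)%N.
Proof. by rewrite abszN. Qed.

Lemma mem_zrange (B : nat) (k : int) :
  (k \in [seq i%:Z - B%:Z | i <- iota 0 (2 * B).+1]) = (`|k| <= B)%N.
Proof.
apply/mapP/idP => [[i]|le]; first by rewrite mem_iota => /andP [_ lt] ->; lia.
by exists `|(k + B%:Z)%R|%N; [rewrite mem_iota; lia | lia].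
Qed.

(** * Sizes of integer expressions, in the form [c N ^ k] *)

Section PolynomialSize.

Variable N : nat.
Hypothesis N_ge1000 : (1000 <= N)%N.

Let N_gt0 : (0 < N)%N.
Proof. exact: leq_trans N_ge1000. Qed.

Lemma size_leM (c k c' k' : nat) (x y : int) :
  (`|x| <= c * N ^ k -> `|y| <= c' * N ^ k' ->
   `|(x * y)%R| <= (c * c') * N ^ (k + k'))%N.
Proof. by move=> lex ley; rewrite expnD mulnACA absz_leM. Qed.

Lemma size_leD (c k c' k' : nat) (x y : int) :
  (`|x| <= c * N ^ k -> `|y| <= c' * N ^ k' ->
   `|(x + y)%R| <= (c + c') * N ^ (maxn k k'))%N.
Proof.
move=> lex ley; rewrite mulnDl absz_leD //.
  by apply: leq_trans lex _; rewrite leq_mul2l leq_pexp2l ?leq_maxl ?orbT.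
by apply: leq_trans ley _; rewrite leq_mul2l leq_pexp2l ?leq_maxr ?orbT.
Qed.

Lemma size_leC (c : nat) (x : int) :
  (`|x| <= c -> `|x| <= c * N ^ 0)%N.
Proof. by rewrite expn0 muln1. Qed.

Lemma size_leX (k : nat) (x : int) : (`|x| <= N ^ k -> `|x| <= 1 * N ^ k)%N.
Proof. by rewrite mul1n. Qed.

(** As [1000 <= N], a constant up to 1000 costs only one more power of [N], so constants need not be
    carried from one bound to the next. *)
Lemma size_leE (c k l : nat) (x : int) :
  (`|x| <= c * N ^ k -> c <= 1000 -> k < l -> `|x| <= N ^ l)%N.
Proof.
move=> lex c_le lt_kl; apply: leq_trans lex _.
apply: leq_trans (_ : N ^ k.+1 <= _)%N; last by rewrite leq_pexp2l.
by rewrite expnS leq_mul2r (leq_trans c_le) ?orbT.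
Qed.

End PolynomialSize.

Ltac size_leaf :=
  match goal with
  | H : is_true (absz ?x <= ?c * ?N ^ ?k)%N |- is_true (absz ?x <= _)%N => exact H
  | H : is_true (absz ?x <= ?N ^ ?k)%N |- is_true (absz ?x <= _)%N =>
      exact (size_leX H)
  | |- is_true (absz ?x <= _)%N => exact (size_leC _ (leqnn (absz x)))
  end.

(** The bound [c N ^ k] is synthesized from the shape of the expression, with [c] and [k] as
    unification variables; only then are [c <= 1000] and [k < l] checked by computation. *)
Ltac size_tac :=
  match goal with H : is_true (1000 <= ?N)%N |- _ =>
    eapply (size_leE H);
    [ repeat match goal with
      | |- is_true (absz (_ * _)%R <= _)%N => eapply size_leM
      | |- is_true (absz (_ + _)%R <= _)%N => eapply (size_leD H)
      | |- is_true (absz (- _)%R <= _)%N => apply: absz_leN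
      | _ => size_leaf
      end
    | vm_compute; reflexivity | vm_compute; reflexivity ]
  end.

(** * Clearing denominators in sums of reciprocals *)

Lemma recip2_expand (F : fieldType) (m v w xi : F) :
  m + v != 0 -> m + w != 0 -> xi != 0 -> (m + v)^-1 + (m + w)^-1 = xi ->
  v * w = (xi^-1 - m) * (v + w) + (2%:R * m * xi^-1 - m ^+ 2).
Proof.
move=> x0 y0 xi0 E.
have E' : xi * ((m + v) * (m + w)) = m + v + (m + w).
  by rewrite -E; field; rewrite y0 x0.
have -> : v * w = (m + v) * (m + w) - m * (v + w) - m ^+ 2 by ring.
by rewrite -(mulKf xi0 ((m + v) * (m + w))) E'; ring.
Qed.

Lemma recip3_expand (F : fieldType) (m u v w lam : F) :
  m + u != 0 -> m + v != 0 -> m + w != 0 -> lam != 0 ->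
  (m + u)^-1 + (m + v)^-1 + (m + w)^-1 = lam ->
  u * v * w = - ((m - lam^-1) * (u * v + u * w + v * w)
               + (m ^+ 2 - 2%:R * m * lam^-1) * (u + v + w)
               + (m ^+ 3 - 3%:R * m ^+ 2 * lam^-1)).
Proof.
move=> x0 y0 z0 lam0 E.
have E' : lam * ((m + u) * (m + v) * (m + w)) =
    (m + u) * (m + v) + (m + u) * (m + w) + (m + v) * (m + w).
  by rewrite -E; field; rewrite z0 y0 x0.
have -> : u * v * w = (m + u) * (m + v) * (m + w) - m * (u * v + u * w + v * w)
    - m ^+ 2 * (u + v + w) - m ^+ 3 by ring.
by rewrite -(mulKf lam0 ((m + u) * (m + v) * (m + w))) E'; ring.
Qed.

(** * Algebraic identities *)

(* If the discriminant of a T^3 + 3 b T^2 + 3 c T + d vanishes, then - r / q is a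
   double root of this polynomial, where r = b c - a d and q = 2 (b^2 - a c). *)
Lemma double_root (A : comNzRingType) (a b c d : A) :
  let r := b * c - a * d in let q := 2%:R * (b ^+ 2 - a * c) in
  4%:R * (b ^+ 2 - a * c) * (c ^+ 2 - b * d) = (b * c - a * d) ^+ 2 ->
  a * r ^+ 2 - 2%:R * b * r * q + c * q ^+ 2 = 0 /\
  b * r ^+ 2 - 2%:R * c * r * q + d * q ^+ 2 = 0.
Proof.
move=> r q /eqP; rewrite -subr_eq0 => /eqP disc0; split.
  rewrite -[RHS](mulr0 (- a)) -disc0 /r /q; ring.
by rewrite -[RHS](mulr0 (- b)) -disc0 /r /q; ring.
Qed.

(** Moving the double root to 0 by the substitution [x = r + q u] kills the linear and constant
    terms of the cubic, hence also those of its polarization, the symmetric equation in [u], [v],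
    [w]. The proof is an identity free of division. *)
Lemma double_root_shift (A : comNzRingType) (a b c d q r u v w : A) :
  a * r ^+ 2 - 2%:R * b * r * q + c * q ^+ 2 = 0 ->
  b * r ^+ 2 - 2%:R * c * r * q + d * q ^+ 2 = 0 ->
  let x := r + q * u in let y := r + q * v in let z := r + q * w in
  a * (u * v * w) + b * (u * v + u * w + v * w) + c * (u + v + w) + d = 0 ->
  a * (x * y * z) = (a * r - b * q) * (x * y + x * z + y * z).
Proof.
move=> E1 E2 x y z F0; apply/eqP; rewrite -subr_eq0; apply/eqP.
pose F := a * (u * v * w) + b * (u * v + u * w + v * w) + c * (u + v + w) + d.
pose G1 := a * r ^+ 2 - 2%:R * b * r * q + c * q ^+ 2.
pose G2 := b * r ^+ 2 - 2%:R * c * r * q + d * q ^+ 2.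
transitivity (q ^+ 3 * F - q * (u + v + w) * G1 - q * G2 - 2%:R * r * G1).
  by rewrite /F /G1 /G2 /x /y /z; ring.
by rewrite /F /G1 /G2 F0 E1 E2; ring.
Qed.

Lemma divz_gcd_spec (x y : int) : x != 0 -> let g := gcdz x y in
  [/\ x = g * (x %/ g)%Z, y = g * (y %/ g)%Z, g != 0, (x %/ g)%Z != 0 &
      coprimez (x %/ g)%Z (y %/ g)%Z].
Proof.
move=> x0 g.
have g0 : g != 0 by rewrite gcdz_eq0 negb_and x0.
have Ex : x = g * (x %/ g)%Z by rewrite mulrC divzK ?dvdz_gcdl.
have Ey : y = g * (y %/ g)%Z by rewrite mulrC divzK ?dvdz_gcdr.
split=> //; first by apply: contraNneq x0 => x'0; rewrite Ex x'0 mulr0.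
apply/coprimezP; have [u [v E]] := Bezoutz x y; exists (u, v); apply: (mulfI g0).
transitivity (u * (g * (x %/ g)%Z) + v * (g * (y %/ g)%Z)); first by rewrite /=; ring.
by rewrite -Ex -Ey mulr1.
Qed.

Lemma dvdz_mul_gcd (w c x : int) : (w %| c * x)%Z -> (w %| c * gcdz w x)%Z.
Proof.
move=> wcx; have [u [v <-]] := Bezoutz w x.
by rewrite mulrDr; apply: rpredD; [rewrite mulrA dvdz_mull | rewrite mulrCA dvdz_mull].
Qed.

(** The gcd divides [b y] and is coprime to [y]. *)
Lemma gcdz_part_dvd (w x y b c : int) :
  coprimez x y -> w = c * x - b * y -> (gcdz w x %| b)%Z.
Proof.
move=> cop Ew; have cop' : coprimez (gcdz w x) y.
  by apply: coprimez_dvdl cop; apply: dvdz_gcdr.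
rewrite -(Gauss_dvdzl _ cop').
have -> : b * y = c * x - w by rewrite Ew; ring.
by apply: rpredB; rewrite ?dvdz_gcdl // dvdz_mull // dvdz_gcdr.
Qed.

Section Reciprocals.

Variables a b x y z : int.
Hypotheses (x0 : x != 0) (y0 : y != 0) (z0 : z != 0).
Hypothesis rel : a * (x * y * z) = b * (x * y + x * z + y * z).

(** Solving for [z] gives [b h x1 y1 = w z], where [w] is the divisor in the conclusion. The gcds of
    [w] with [x1] and with [y1] divide [b], so each of [x1], [y1] can be traded for a factor [b]. *)
Lemma gcd_dvd (x1 y1 h : int) : x = h * x1 -> y = h * y1 -> coprimez x1 y1 ->
  (a * h * x1 * y1 - b * (x1 + y1) %| b ^+ 3 * h)%Z.
Proof.
move=> Ex Ey cop; set w := _ - _.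
have h0 : h != 0 by apply: contraNneq x0 => h0; rewrite Ex h0 mul0r.
have dw : (w %| (b * h * x1) * y1)%Z.
  suff -> : b * h * x1 * y1 = w * z by apply: dvdz_mulr.
  apply: (mulfI h0); apply/eqP; rewrite -subr_eq0; apply/eqP.
  transitivity (b * (x * y + x * z + y * z) - a * (x * y * z)).
    by rewrite Ex Ey /w; ring.
  by rewrite rel subrr.
have dy : (gcdz w y1 %| b)%Z.
  apply: (@gcdz_part_dvd w y1 x1 b (a * h * x1 - b)); first by rewrite coprimez_sym.
  by rewrite /w; ring.
have dx : (gcdz w x1 %| b)%Z.
  by apply: (@gcdz_part_dvd w x1 y1 b (a * h * y1 - b)) => //; rewrite /w; ring.
have {}dw : (w %| (b ^+ 2 * h) * x1)%Z.
  have -> : b ^+ 2 * h * x1 = b * h * x1 * b by ring.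
  by apply: dvdz_trans (dvdz_mul_gcd dw) _; rewrite dvdz_mul.
have -> : b ^+ 3 * h = b ^+ 2 * h * b by ring.
by apply: dvdz_trans (dvdz_mul_gcd dw) _; rewrite dvdz_mul.
Qed.

(** Cancelling [h3 h2 e] leaves [a x e y' z' = b (x2 y' + x1 z' + e y' z')], and reduction modulo
    [y'] and [z'] gives the divisibilities. By the last equation [e] divides [b q (k2 y' + k3 z')],
    which is how it is counted later. *)
Lemma reciprocals_param (h3 h2 x1 y1 x2 z2 e y' z' k3 k2 q : int) :
  x = h3 * x1 -> y = h3 * y1 -> coprimez x1 y1 ->
  x = h2 * x2 -> z = h2 * z2 -> coprimez x2 z2 ->
  y1 = e * y' -> z2 = e * z' -> coprimez y' z' ->
  x1 - y1 = q * k3 -> x2 - z2 = q * k2 ->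
  [/\ (y' %| b)%Z, (z' %| b)%Z &
      a * x * (e * y' * z') = b * (3%:R * (e * y' * z') + q * (k2 * y' + k3 * z'))].
Proof.
move=> Ex3 Ey cop3 Ex2 Ez cop2 Ey1 Ez2 cop D3 D2.
have h30 : h3 != 0 by apply: contraNneq y0 => h0; rewrite Ey h0 mul0r.
have h20 : h2 != 0 by apply: contraNneq z0 => h0; rewrite Ez h0 mul0r.
have e0 : e != 0 by apply: contraNneq y0 => h0; rewrite Ey Ey1 h0 mul0r mulr0.
have E : a * x * (e * y' * z') = b * (x2 * y' + x1 * z' + e * y' * z').
  apply: (mulfI (mulf_neq0 (mulf_neq0 h30 h20) e0)).
  transitivity (a * (x * y * z)); first by rewrite Ey Ey1 Ez Ez2; ring.
  rewrite rel Ey Ey1 Ez Ez2.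
  transitivity (b * (h3 * h2 * e * (e * y' * z') + h3 * e * y' * x + h2 * e * z' * x)).
    by ring.
  by rewrite {1}Ex2 Ex3; ring.
have copy : coprimez x1 y' by move: cop3; rewrite Ey1 coprimezMr => /andP [].
have copz : coprimez x2 z' by move: cop2; rewrite Ez2 coprimezMr => /andP [].
split.
- rewrite coprimez_sym in copy.
  rewrite -(Gauss_dvdzl _ copy) -(Gauss_dvdzl _ cop).
  have -> : b * x1 * z' = y' * (a * x * e * z' - b * x2 - b * e * z').
    transitivity (b * (x2 * y' + x1 * z' + e * y' * z') - y' * (b * x2 + b * e * z')).
      by ring.
    by rewrite -E; ring.
  exact: dvdz_mulr.
- rewrite coprimez_sym in copz; rewrite coprimez_sym in cop.
  rewrite -(Gauss_dvdzl _ copz) -(Gauss_dvdzl _ cop).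
  have -> : b * x2 * y' = z' * (a * x * e * y' - b * x1 - b * e * y').
    transitivity (b * (x2 * y' + x1 * z' + e * y' * z') - z' * (b * x1 + b * e * y')).
      by ring.
    by rewrite -E; ring.
  exact: dvdz_mulr.
have Ex1 : x1 = e * y' + q * k3 by rewrite -D3 -Ey1; ring.
have Ex2' : x2 = e * z' + q * k2 by rewrite -D2 -Ez2; ring.
by rewrite E Ex1 Ex2'; ring.
Qed.

End Reciprocals.

(** * Reciprocals in an interval *)

Section Interval.

Variables (p : nat) (M : int) (N : nat).
Hypotheses (p_pr : prime p) (N_ge1000 : (1000 <= N)%N) (ltN15p : (N ^ 15 < p)%N).

Definition elt (i : 'I_N) : 'F_p := (M + (i : nat)%:Z)%:~R.

Hypothesis elt_neq0 : forall i, elt i != 0.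

Lemma intr_Fp_small (z : int) : z%:~R = 0 :> 'F_p -> (`|z| < p)%N -> z = 0.
Proof.
move=> /eqP; rewrite -(dvdz_pcharf (pchar_Fp p_pr)) dvdzE => dv lt.
apply/eqP; rewrite -absz_eq0 -[_ == _]negbK -lt0n; apply/negP => z_gt0.
by have := dvdn_leq z_gt0 dv; rewrite leqNgt lt.
Qed.

Lemma intr_Fp_eq0 (z : int) : z%:~R = 0 :> 'F_p -> (`|z| <= N ^ 15)%N -> z = 0.
Proof. by move=> z0 zN; apply: intr_Fp_small (leq_ltn_trans zN _). Qed.

Lemma ord_size (i : 'I_N) : (`|(i : nat)%:Z| <= 1 * N ^ 1)%N.
Proof. by rewrite mul1n expn1 absz_nat ltnW. Qed.

Lemma elt_inj : injective elt.
Proof.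
move=> i j eq_ij; apply: val_inj => /=.
have d0 : ((i : nat)%:Z - (j : nat)%:Z)%:~R = 0 :> 'F_p.
  by rewrite /elt !intrD in eq_ij; rewrite intrB (addrI _ eq_ij) subrr.
have hi := ord_size i; have hj := ord_size j.
suff : (i : nat)%:Z - (j : nat)%:Z = 0 by lia.
by apply: intr_Fp_eq0 => //; size_tac.
Qed.

Variable T : nat.
Hypothesis T_ge2 : (2 <= T)%N.
(* 60 is a crude bound for the size of all integers to which this is applied. *)
Hypothesis few_divisors : forall z : int, z != 0 -> (`|z| <= N ^ 60)%N ->
  (size (zdivisors z) <= T)%N.

(** The form in which divisor bounds are used: a quantity dividing a fixed nonzero integer takes at
    most [T] values. *)
Lemma leq_card_divisors (U : finType) (S : {set U}) (f : U -> int) (z : int)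
    (B : nat) :
  z != 0 -> (`|z| <= N ^ 60)%N -> {in S, forall s, (f s %| z)%Z} ->
  (forall k, (#|[set s in S | f s == k]| <= B)%N) -> (#|S| <= T * B)%N.
Proof.
move=> z0 zN fz fib.
apply: leq_trans (_ : size (zdivisors z) * B <= _)%N; last first.
  by rewrite leq_mul2r few_divisors ?orbT.
by apply: (leq_card_fibers (f := f)) => // s /fz; apply: mem_zdivisors.
Qed.

(** * Two reciprocals with a given sum *)

Definition recip_pairs (xi : 'F_p) : {set 'I_N * 'I_N} :=
  [set t | (elt t.1)^-1 + (elt t.2)^-1 == xi].

Lemma recip_pair_inj (xi : 'F_p) (i j k : 'I_N) :
  (i, j) \in recip_pairs xi -> (i, k) \in recip_pairs xi -> j = k.
Proof.
by rewrite !inE /= => /eqP <- /eqP /addrI /invr_inj /elt_inj.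
Qed.

Lemma recip_pairs_sym (xi : 'F_p) (i j : 'I_N) :
  ((i, j) \in recip_pairs xi) = ((j, i) \in recip_pairs xi).
Proof. by rewrite !inE addrC. Qed.

Lemma recip_pairs_rel (xi : 'F_p) (i j : 'I_N) : xi != 0 ->
  (i, j) \in recip_pairs xi ->
  let v : int := (i : nat)%:Z in let w : int := (j : nat)%:Z in
  (v * w)%:~R = (xi^-1 - M%:~R) * (v + w)%:~R
              + (2%:R * M%:~R * xi^-1 - M%:~R ^+ 2) :> 'F_p.
Proof.
move=> xi0; rewrite inE /= /elt !intrD intrM => /eqP E.
by apply: recip2_expand; rewrite // -intrD elt_neq0.
Qed.

(** Fix one solution [(v0, w0)]. The changes [d1], [d2] of sum and product are proportional modulo
    [p], hence over the integers, so the quadratics with roots [v], [w] are [P0] minus rational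
    multiples of one linear [Q]. Then [Q v] divides the resultant [Q v0 * Q w0], and it determines
    [v]. *)
Lemma card_recip_pairs (xi : 'F_p) : xi != 0 -> (#|recip_pairs xi| <= T)%N.
Proof.
move=> xi0; set S := recip_pairs xi.
have [->|[[i0 j0] S0]] := set_0Vmem S; first by rewrite cards0.
have S0' : (j0, i0) \in S by rewrite recip_pairs_sym.
pose v0 : int := (i0 : nat)%:Z; pose w0 : int := (j0 : nat)%:Z.
pose P0 (x : int) := (x - v0) * (x - w0).
pose d1 (t : 'I_N * 'I_N) : int := (t.1 : nat)%:Z + (t.2 : nat)%:Z - (v0 + w0).
pose d2 (t : 'I_N * 'I_N) : int := (t.1 : nat)%:Z * (t.2 : nat)%:Z - v0 * w0.
pose A : 'F_p := xi^-1 - M%:~R.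
have hv0 : (`|v0| <= 1 * N ^ 1)%N := ord_size i0.
have hw0 : (`|w0| <= 1 * N ^ 1)%N := ord_size j0.
have d21 t : t \in S -> (d2 t)%:~R = A * (d1 t)%:~R.
  case: t => i j St; rewrite /d1 /d2 !intrB (recip_pairs_rel xi0 St).
  by rewrite (recip_pairs_rel xi0 S0) /= -/A; ring.
have d2N t : (`|d2 t| <= N ^ 3)%N.
  by have h1 := ord_size t.1; have h2 := ord_size t.2; rewrite /d2; size_tac.
have d1N t : (`|d1 t| <= N ^ 2)%N.
  by have h1 := ord_size t.1; have h2 := ord_size t.2; rewrite /d1; size_tac.
have d1_neq0 t : t \in S -> d1 t = 0 -> d2 t = 0.
  move=> St d10; apply: intr_Fp_eq0; last by have := d2N t => ?; size_tac.
  by rewrite d21 // d10 mulr0.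
have P0root t : t \in S -> P0 (t.1 : nat)%:Z = d1 t * (t.1 : nat)%:Z - d2 t.
  by move=> _; rewrite /P0 /d1 /d2; ring.
have [/existsP [[i1 j1] /andP [St1 d1t1]]|] :=
    boolP [exists t, (t \in S) && (d1 t != 0)]; last first.
  rewrite negb_exists => /forallP d10.
  (* With unchanged sum and product only the fixed solution and its mirror image remain; here
     [2 <= T] enters. *)
  have subS : S \subset [set (i0, j0); (j0, i0)].
    apply/subsetP => -[i j] St; rewrite !inE.
    have d1t : d1 (i, j) = 0.
      by move: (d10 (i, j)); rewrite St /= negbK => /eqP.
    have := P0root _ St; rewrite d1t (d1_neq0 _ St d1t) mul0r subr0 /= => /eqP.
    rewrite mulf_eq0 !subr_eq0 !eqz_nat => /orP [] /eqP /val_inj E.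
      by move: St; rewrite E => /(recip_pair_inj S0) ->; rewrite eqxx.
    by move: St; rewrite E => /(recip_pair_inj S0') ->; rewrite eqxx orbT.
  by apply: leq_trans (subset_leq_card subS) _; rewrite cards2; lia.
pose t1 := (i1, j1); pose a := d1 t1; pose b := d2 t1; pose Q (x : int) := a * x - b.
have ha : (`|a| <= N ^ 2)%N := d1N t1.
have hb : (`|b| <= N ^ 3)%N := d2N t1.
(* A zero of Q would be a common root of the polynomials attached to both
   solutions, which would then be equal up to the order. *)
have Qneq0 i j : (i, j) \in S -> d1 (i, j) = 0 -> d2 (i, j) = 0 ->
    P0 (i : nat)%:Z = 0 -> Q (i : nat)%:Z != 0.
  move=> St d1ij d2ij Pi; apply/eqP => Qi.
  have : ((i : nat)%:Z - (i1 : nat)%:Z) * ((i : nat)%:Z - (j1 : nat)%:Z) = 0.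
    transitivity (P0 (i : nat)%:Z - Q (i : nat)%:Z); last by rewrite Pi Qi subr0.
    by rewrite /P0 /Q /a /b /d1 /d2; ring.
  move/eqP: (d1t1) => d1t1'.
  move/eqP; rewrite mulf_eq0 !subr_eq0 !eqz_nat => /orP [] /eqP /val_inj E.
    by apply: d1t1'; move: St1; rewrite -E => /(recip_pair_inj St) <-.
  apply: d1t1'; move: St1; rewrite -E recip_pairs_sym => /(recip_pair_inj St) <-.
  by rewrite -d1ij /d1 /=; ring.
have d10 : d1 (i0, j0) = 0 by rewrite /d1 subrr.
have d20 : d2 (i0, j0) = 0 by rewrite /d2 subrr.
have d10' : d1 (j0, i0) = 0 by rewrite /d1 /v0 /w0 /=; ring.
have d20' : d2 (j0, i0) = 0 by rewrite /d2 /v0 /w0 /=; ring.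
have Qv0 : Q v0 != 0 by apply: (Qneq0 i0 j0) => //; rewrite /P0 subrr mul0r.
have Qw0 : Q w0 != 0 by apply: (Qneq0 j0 i0) => //; rewrite /P0 subrr mulr0.
have Z0 : Q v0 * Q w0 != 0 by rewrite mulf_neq0.
pose f (t : 'I_N * 'I_N) := Q (t.1 : nat)%:Z.
rewrite -[leqRHS]muln1; apply: (leq_card_divisors (f := f) Z0).
- by rewrite /Q; size_tac.
- move=> t St; rewrite /f; set v := (t.1 : nat)%:Z.
  have par : d2 t * a = d1 t * b.
    apply/eqP; rewrite -subr_eq0; apply/eqP/intr_Fp_eq0.
      by rewrite intrB !intrM d21 // (d21 t1) //; ring.
    have ht := d1N t.
    have ht' := d2N t; size_tac.
  have aP0 : a * P0 v = d1 t * Q v.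
    by rewrite (P0root _ St) -/v /Q mulrBr [a * d2 t]mulrC par; ring.
  (* Expand [(Q v + a (v0 - v)) (Q v + a (w0 - v))]; its last term [a ^ 2 P0 v] is again a multiple
     of [Q v]. *)
  have -> : Q v0 * Q w0 = Q v * (Q v + a * (v0 - v) + a * (w0 - v) + a * d1 t).
    transitivity (Q v * (Q v + a * (v0 - v) + a * (w0 - v)) + a * (a * P0 v)).
      by rewrite /Q /P0; ring.
    by rewrite aP0; ring.
  by rewrite dvdz_mulr.
move=> k; rewrite leqNgt; apply/negP => /card_gt1P [[i j] [[i' j'] []]].
rewrite !inE => /andP [St /eqP Et] /andP [St' /eqP Et'] /eqP [].
have E : i = i'.
  apply: val_inj; apply/eqP; rewrite -eqz_nat; apply/eqP/(mulfI d1t1).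
  by apply: (addIr (- b)); rewrite -/a; apply: etrans Et (esym Et').
move: St St'; rewrite -E => St St'.
by have := @recip_pair_inj xi i j j'; rewrite !inE => ->.
Qed.

Lemma card_quadratic_fiber (a1 a2 a3 k : int) : (a1 != 0) || (a2 != 0) ->
  (#|[set i : 'I_N | (a1 * (i : nat)%:Z ^+ 2 - a2 * (i : nat)%:Z + a3)%R == k]|
     <= 2)%N.
Proof.
move=> a12; set S := [set i | _].
have [->|[i0 Si0]] := set_0Vmem S; first by rewrite cards0.
(* Subtracting the equations of [i] and [i0] leaves [(i - i0) (a1 (i + i0) - a2) = 0]. *)
pose S' := [set i : 'I_N | a1 * ((i : nat)%:Z + (i0 : nat)%:Z) == a2].
have subS : S \subset i0 |: S'.
  apply/subsetP => i; move: Si0; rewrite !inE => /eqP E0 /eqP E1.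
  rewrite -val_eqE /= -eqz_nat -subr_eq0 -[X in _ || X]subr_eq0 -mulf_eq0.
  by apply/eqP; apply: etrans (_ : k - k = 0); [rewrite -{1}E1 -E0|]; ring.
apply: leq_trans (subset_leq_card subS) _; rewrite cardsU1 -addn1 addnC.
apply: leq_trans (_ : 1 + 1 <= 2)%N => //; apply: leq_add; last by case: (_ \in _).
rewrite leqNgt; apply/negP => /card_gt1P [i [j []]]; rewrite !inE => /eqP Ei.
rewrite -Ei -subr_eq0 -mulrBr mulf_eq0 => /orP [/eqP a10|].
  by move: a12; rewrite -Ei a10 mul0r eqxx.
by move=> /eqP E /eqP []; apply: val_inj => /=; lia.
Qed.

(** * Three reciprocals and the points [(esym1, esym2, esym3)] *)

Variable lam : 'F_p.
Hypotheses (lam_neq0 : lam != 0) (lamB_neq0 : forall i, lam - (elt i)^-1 != 0).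

Local Notation triple := ('I_N * 'I_N * 'I_N)%type.

Definition recip_triples : {set triple} :=
  [set t : triple | (elt t.1.1)^-1 + (elt t.1.2)^-1 + (elt t.2)^-1 == lam].

Definition coords (t : triple) : seq 'I_N := [:: t.1.1; t.1.2; t.2].

(** Fixing one coordinate leaves two reciprocals whose sum is [lam] minus a reciprocal; this is
    nonzero by [lamB_neq0], as the count of pairs requires. Each of the three positions contributes
    [T]. *)
Lemma card_recip_triples_coord (i : 'I_N) :
  (#|[set t in recip_triples | i \in coords t]| <= 3 * T)%N.
Proof.
have bound (f : triple -> 'I_N) (g : triple -> 'I_N * 'I_N) :
    injective (fun t => (f t, g t)) ->
    (forall t, t \in recip_triples ->
       (elt (g t).1)^-1 + (elt (g t).2)^-1 = lam - (elt (f t))^-1) ->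
    (#|[set t in recip_triples | f t == i]| <= T)%N.
  move=> fg_inj fgE; apply: leq_trans (card_recip_pairs (lamB_neq0 i)).
  rewrite -(card_in_imset (f := g)).
    apply/subset_leq_card/subsetP => _ /imsetP [t + ->].
    by rewrite inE => /andP [/fgE E /eqP <-]; rewrite inE E.
  move=> t t'; rewrite inE => /andP [_ /eqP ft]; rewrite inE => /andP [_ /eqP ft'].
  by move=> gt; apply: fg_inj; rewrite ft ft' gt.
rewrite mulSn mulSn mul1n addnA.
apply: leq_trans (_ : #|[set t in recip_triples | t.1.1 == i] :|:
    [set t in recip_triples | t.1.2 == i] :|:
    [set t in recip_triples | t.2 == i]| <= _)%N.
  apply/subset_leq_card/subsetP => t; rewrite !inE => /andP [-> /or3P []] /eqP ->;
    by rewrite eqxx ?orbT.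
apply: leq_trans (leq_card_setU _ _) _; apply: leq_add.
  apply: leq_trans (leq_card_setU _ _) _; apply: leq_add.
    apply: (bound (fun t => t.1.1) (fun t => (t.1.2, t.2))).
      by move=> [[? ?] ?] [[? ?] ?] [] /= -> -> ->.
    by move=> t; rewrite inE => /eqP <- /=; ring.
  apply: (bound (fun t => t.1.2) (fun t => (t.1.1, t.2))).
    by move=> [[? ?] ?] [[? ?] ?] [] /= -> -> ->.
  by move=> t; rewrite inE => /eqP <- /=; ring.
apply: (bound (fun t => t.2) (fun t => (t.1.1, t.1.2))).
  by move=> [[? ?] ?] [[? ?] ?] [] /= -> -> ->.
by move=> t; rewrite inE => /eqP <- /=; ring.
Qed.

Definition esym1 (t : triple) : int :=
  (t.1.1 : nat)%:Z + (t.1.2 : nat)%:Z + (t.2 : nat)%:Z.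
Definition esym2 (t : triple) : int :=
  (t.1.1 : nat)%:Z * (t.1.2 : nat)%:Z + (t.1.1 : nat)%:Z * (t.2 : nat)%:Z
  + (t.1.2 : nat)%:Z * (t.2 : nat)%:Z.
Definition esym3 (t : triple) : int :=
  (t.1.1 : nat)%:Z * (t.1.2 : nat)%:Z * (t.2 : nat)%:Z.

Lemma esym1_size (t : triple) : (`|esym1 t| <= 3 * N ^ 1)%N.
Proof.
exact: (size_leD N_ge1000 (size_leD N_ge1000 (ord_size _) (ord_size _)) (ord_size _)).
Qed.

Lemma esym2_size (t : triple) : (`|esym2 t| <= 3 * N ^ 2)%N.
Proof.
have lt2 (i j : 'I_N) := size_leM (ord_size i) (ord_size j).
exact: (size_leD N_ge1000 (size_leD N_ge1000 (lt2 _ _) (lt2 _ _)) (lt2 _ _)).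
Qed.

Lemma esym3_size (t : triple) : (`|esym3 t| <= 1 * N ^ 3)%N.
Proof. exact: (size_leM (size_leM (ord_size _) (ord_size _)) (ord_size _)). Qed.

(** Modulo [p], [Z^3 + 3 rel2 Z^2 + 3 rel1 Z + rel0] is [(Z + M)^2 (Z + M - 3 / lam)]; the equation
    for triples is its polarization. *)
Definition rel2 : 'F_p := M%:~R - lam^-1.
Definition rel1 : 'F_p := M%:~R ^+ 2 - 2%:R * M%:~R * lam^-1.
Definition rel0 : 'F_p := M%:~R ^+ 3 - 3%:R * M%:~R ^+ 2 * lam^-1.

Lemma esym_rel (t : triple) : t \in recip_triples ->
  (esym3 t)%:~R
  = - (rel2 * (esym2 t)%:~R + rel1 * (esym1 t)%:~R + rel0) :> 'F_p.
Proof.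
rewrite inE /elt !intrD => /eqP E; rewrite /esym1 /esym2 /esym3 !(intrD, intrM).
by apply: recip3_expand; rewrite // -intrD elt_neq0.
Qed.

Definition cubic (t : triple) (x : int) : int :=
  (x - (t.1.1 : nat)%:Z) * (x - (t.1.2 : nat)%:Z) * (x - (t.2 : nat)%:Z).

Lemma cubicE (t : triple) (x : int) :
  cubic t x = x ^+ 3 - esym1 t * x ^+ 2 + esym2 t * x - esym3 t.
Proof. by rewrite /cubic /esym1 /esym2 /esym3; ring. Qed.

Lemma cubic_eq0 (t : triple) (i : 'I_N) :
  (cubic t (i : nat)%:Z == 0) = (i \in coords t).
Proof. by rewrite /cubic !mulf_eq0 !subr_eq0 !eqz_nat !val_eqE !inE orbA. Qed.

Definition diff1 (s t : triple) : int := esym1 t - esym1 s.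
Definition diff2 (s t : triple) : int := esym2 t - esym2 s.
Definition diff3 (s t : triple) : int := esym3 t - esym3 s.

Lemma diff1_size (s t : triple) : (`|diff1 s t| <= 6 * N ^ 1)%N.
Proof.
exact: (size_leD N_ge1000 (esym1_size _) (absz_leN (esym1_size _))).
Qed.

Lemma diff2_size (s t : triple) : (`|diff2 s t| <= 6 * N ^ 2)%N.
Proof.
exact: (size_leD N_ge1000 (esym2_size _) (absz_leN (esym2_size _))).
Qed.

Lemma diff3_size (s t : triple) : (`|diff3 s t| <= 2 * N ^ 3)%N.
Proof.
exact: (size_leD N_ge1000 (esym3_size _) (absz_leN (esym3_size _))).
Qed.

Lemma diff_rel (s t : triple) : s \in recip_triples -> t \in recip_triples ->
  (diff3 s t)%:~R
  = - (rel2 * (diff2 s t)%:~R + rel1 * (diff1 s t)%:~R) :> 'F_p.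
Proof.
by move=> Ss St; rewrite !intrB !esym_rel //; ring.
Qed.

Lemma cubic_diff (s t : triple) (x : int) :
  cubic s x = cubic t x + (diff1 s t * x ^+ 2 - diff2 s t * x + diff3 s t).
Proof. by rewrite !cubicE /diff1 /diff2 /diff3; ring. Qed.

(* (normal1, normal2, normal3) is a normal vector of the plane through the
   points (esym1, esym2, esym3) attached to three triples. *)
Definition normal1 (r s t : triple) : int :=
  diff2 r s * diff3 r t - diff3 r s * diff2 r t.
Definition normal2 (r s t : triple) : int :=
  diff3 r s * diff1 r t - diff1 r s * diff3 r t.
Definition normal3 (r s t : triple) : int :=
  diff1 r s * diff2 r t - diff2 r s * diff1 r t.

Lemma normal1_size (r s t : triple) : (`|normal1 r s t| <= 24 * N ^ 5)%N.
Proof.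
exact: (size_leD N_ge1000 (size_leM (diff2_size _ _) (diff3_size _ _))
  (absz_leN (size_leM (diff3_size _ _) (diff2_size _ _)))).
Qed.

Lemma normal2_size (r s t : triple) : (`|normal2 r s t| <= 24 * N ^ 4)%N.
Proof.
exact: (size_leD N_ge1000 (size_leM (diff3_size _ _) (diff1_size _ _))
  (absz_leN (size_leM (diff1_size _ _) (diff3_size _ _)))).
Qed.

Lemma normal3_size (r s t : triple) : (`|normal3 r s t| <= 72 * N ^ 3)%N.
Proof.
exact: (size_leD N_ge1000 (size_leM (diff1_size _ _) (diff2_size _ _))
  (absz_leN (size_leM (diff2_size _ _) (diff1_size _ _)))).
Qed.

Section Normal.

Variables r s t : triple.
Hypotheses (Sr : r \in recip_triples) (Ss : s \in recip_triples)
  (St : t \in recip_triples).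

(** All points lie modulo [p] on one plane with normal vector [(rel1, rel2, 1)], so every cross
    product is a multiple of this vector. *)
Lemma normal1_rel :
  (normal1 r s t)%:~R = rel1 * (normal3 r s t)%:~R :> 'F_p.
Proof.
have := diff_rel Sr Ss; have := diff_rel Sr St; rewrite /normal1 /normal3.
move: (diff1 r s) (diff2 r s) (diff3 r s) (diff1 r t) (diff2 r t) (diff3 r t).
by move=> a1 a2 a3 b1 b2 b3 Eb Ea; rewrite !(intrB, intrM) Ea Eb; ring.
Qed.

Lemma normal2_rel :
  (normal2 r s t)%:~R = rel2 * (normal3 r s t)%:~R :> 'F_p.
Proof.
have := diff_rel Sr Ss; have := diff_rel Sr St; rewrite /normal2 /normal3.
move: (diff1 r s) (diff2 r s) (diff3 r s) (diff1 r t) (diff2 r t) (diff3 r t).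
by move=> a1 a2 a3 b1 b2 b3 Eb Ea; rewrite !(intrB, intrM) Ea Eb; ring.
Qed.

Lemma normal_eq0 :
  normal3 r s t = 0 -> normal1 r s t = 0 /\ normal2 r s t = 0.
Proof.
have h1 := normal1_size r s t; have h2 := normal2_size r s t.
by move=> n30; split; apply: intr_Fp_eq0; [|size_tac| |size_tac];
  rewrite (normal1_rel, normal2_rel) n30 mulr0.
Qed.

End Normal.

Lemma diff_neq0 (s t : triple) : s \in recip_triples -> t \in recip_triples ->
  diff1 s t = 0 -> diff2 s t = 0 -> diff3 s t = 0.
Proof.
move=> Ss St d10 d20; have h := diff3_size s t.
by apply: intr_Fp_eq0; [rewrite diff_rel // d10 d20; ring | size_tac].
Qed.

Lemma card_line (s t : triple) : s \in recip_triples -> t \in recip_triples ->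
  (diff1 s t != 0) || (diff2 s t != 0) ->
  (#|[set r in recip_triples | normal3 s t r == 0]| <= 8 * T ^ 3)%N.
Proof.
move=> Ss St a12; set L := [set r in _ | _].
pose a1 := diff1 s t; pose a2 := diff2 s t; pose a3 := diff3 s t.
pose Q (x : int) := a1 * x ^+ 2 - a2 * x + a3.
(* The cubics attached to the points of the line form the pencil generated by
   [cubic s] and Q.  Hence Q divides a multiple of [cubic s] at each coordinate
   of such a point, so its value there divides a multiple of the resultant.  If
   the resultant vanishes, all the points share a coordinate. *)
have cubicQ r x a b : r \in L ->
    (a, b) \in [:: (a1, diff1 s r); (a2, diff2 s r)] ->
    a * (cubic s x - cubic r x) = b * Q x.
  rewrite inE => /andP [Sr /eqP n3].
  have [n1 n2] := normal_eq0 Ss St Sr n3.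
  rewrite (cubic_diff s r) !inE => /orP [] /eqP [-> ->].
    transitivity (diff1 s r * Q x - normal3 s t r * x - normal2 s t r);
      last by rewrite n3 n2; ring.
    by rewrite /Q /normal3 /normal2 /a1 /a2 /a3; ring.
  transitivity (diff2 s r * Q x - normal3 s t r * x ^+ 2 + normal1 s t r);
    last by rewrite n3 n1; ring.
  by rewrite /Q /normal3 /normal1 /a1 /a2 /a3; ring.
have [/hasP [i i_s /eqP Qi]|/hasPn Qs] :=
  boolP (has (fun i : 'I_N => Q (i : nat)%:Z == 0) (coords s)).
  apply: leq_trans (_ : 3 * T <= _)%N; last first.
    by rewrite expnS mulnCA mulnC leq_mul2l; nia.
  apply: leq_trans (card_recip_triples_coord i).
  apply/subset_leq_card/subsetP => r Lr; rewrite inE.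
  move: (Lr); rewrite inE => /andP [-> _] /=; rewrite -cubic_eq0.
  move: i_s; rewrite -cubic_eq0 => /eqP si.
  have E a b := cubicQ r (i : nat)%:Z a b Lr.
  case/orP: a12 => a0; apply/eqP/(mulfI a0); apply: oppr_inj.
    by have := E _ _ (mem_head _ _); rewrite Qi si sub0r mulrN !mulr0 oppr0.
  by have := E _ _ (mem_last _ [:: _]); rewrite Qi si sub0r mulrN !mulr0 oppr0.
pose u := (s.1.1 : nat)%:Z; pose v := (s.1.2 : nat)%:Z; pose w := (s.2 : nat)%:Z.
(* Either of [a1], [a2] may vanish; a nonzero one clears the proportionality factor between [Q] and
   the difference of the cubics. *)
pose a := if a1 != 0 then a1 else a2.
have a0 : a != 0 by move: a12; rewrite /a -/a1 -/a2; case: (a1 =P 0) => // /eqP.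
have z0 : a * (Q u * Q v * Q w) != 0.
  by rewrite !mulf_neq0 //; apply: Qs; rewrite !inE eqxx ?orbT.
set z := a * _ in z0.
have h1 := diff1_size s t; have h2 := diff2_size s t; have h3 := diff3_size s t.
have hu := ord_size s.1.1; have hv := ord_size s.1.2; have hw := ord_size s.2.
have ha : (`|a| <= N ^ 3)%N.
  by rewrite /a; case: ifP => _; [rewrite /a1|rewrite /a2]; size_tac.
have hQ x : (`|x| <= 1 * N ^ 1)%N -> (`|Q x| <= N ^ 4)%N.
  by move=> hx; rewrite /Q /a1 /a2 /a3 expr2; size_tac.
have zN : (`|z| <= N ^ 60)%N.
  have := hQ _ hu; have := hQ _ hv; have := hQ _ hw => h4 h5 h6.
  by rewrite /z; size_tac.
pose E := [set i : 'I_N | (Q (i : nat)%:Z %| z)%Z].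
have cardE : (#|E| <= T * 2)%N.
  apply: (leq_card_divisors (f := fun i : 'I_N => Q (i : nat)%:Z) z0 zN).
    by move=> i; rewrite inE.
  move=> k; apply: leq_trans (card_quadratic_fiber a3 k a12).
  by apply/subset_leq_card/subsetP => i; rewrite !inE => /andP [].
have sub r : r \in L -> {subset coords r <= E}.
  move=> Lr i; rewrite -cubic_eq0 inE => /eqP ri.
  set x := (i : nat)%:Z in ri *.
  pose b := if a1 != 0 then diff1 s r else diff2 s r.
  have ab : a * cubic s x = b * Q x.
    rewrite -(cubicQ r x a b Lr) ?ri ?subr0 // /a /b !inE.
    by case: ifP => _; rewrite eqxx ?orbT.
  (* [h y] is the divided difference of [Q], so that [Q y = Q x + (y - x) h y]. The product over
     [u], [v], [w] is [Q x * K - cubic s x * h u * h v * h w]. *)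
  pose h y := a1 * (x + y) - a2.
  pose K := Q x ^+ 2 + Q x * ((u - x) * h u + (v - x) * h v + (w - x) * h w)
    + ((u - x) * h u * ((v - x) * h v) + (u - x) * h u * ((w - x) * h w)
      + (v - x) * h v * ((w - x) * h w)).
  have -> : z = Q x * (a * K - b * (h u * h v * h w)).
    transitivity (Q x * (a * K) - a * cubic s x * (h u * h v * h w)).
      by rewrite /z /K /cubic -/u -/v -/w /h /Q; ring.
    by rewrite ab; ring.
  exact: dvdz_mulr.
apply: leq_trans (_ : #|setX (setX E E) E| <= _)%N.
  apply/subset_leq_card/subsetP => -[[i j] k] Lr; have := sub _ Lr.
  by move=> sE; rewrite !in_setX !sE // !inE eqxx ?orbT.
rewrite !cardsX; apply: (@leq_trans (T * 2 * (T * 2) * (T * 2))).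
  by rewrite !leq_mul.
by rewrite !expnS expn0; lia.
Qed.

(** If some point differs from that of [r], the line through both carries at most [8 T ^ 3] triples.
    Otherwise all triples give the same point, so the same cubic and a common coordinate. *)
Lemma noncollinear (S : {set triple}) : S \subset recip_triples ->
  (8 * T ^ 3 < #|S|)%N ->
  exists r s t, [/\ r \in S, s \in S, t \in S & normal3 r s t != 0].
Proof.
move=> /subsetP subS ltS.
have [S0|[r Sr]] := set_0Vmem S; first by rewrite S0 cards0 in ltS.
have [/existsP [s /andP [Ss d12]]|] :=
    boolP [exists s, (s \in S) && ((diff1 r s != 0) || (diff2 r s != 0))].
  have [/existsP [t /andP [St n3]]|] :=
    boolP [exists t, (t \in S) && (normal3 r s t != 0)]; first by exists r, s, t.
  rewrite negb_exists => /forallP n30; move: ltS; rewrite ltnNge => /negP [].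
  apply: leq_trans (card_line (subS _ Sr) (subS _ Ss) d12).
  apply/subset_leq_card/subsetP => t St; rewrite inE subS //=.
  by have := n30 t; rewrite St negbK.
rewrite negb_exists => /forallP d0; move: ltS; rewrite ltnNge => /negP [].
apply: leq_trans (_ : 3 * T <= _)%N; last first.
  by rewrite expnS mulnCA mulnC leq_mul2l; nia.
apply: leq_trans (card_recip_triples_coord r.1.1).
apply/subset_leq_card/subsetP => t St; rewrite inE subS //= -cubic_eq0.
have := d0 t; rewrite St negb_or !negbK /= => /andP [/eqP d1 /eqP d2].
have := cubic_diff r t (r.1.1 : nat)%:Z; rewrite d1 d2 diff_neq0 ?subS //.
rewrite !mul0r subrr !addr0 => <-.
by rewrite cubic_eq0 inE eqxx.
Qed.

Lemma normal_parallel (r s t r' s' t' : triple) :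
  r \in recip_triples -> s \in recip_triples -> t \in recip_triples ->
  r' \in recip_triples -> s' \in recip_triples -> t' \in recip_triples ->
  normal3 r s t * normal1 r' s' t' = normal3 r' s' t' * normal1 r s t /\
  normal3 r s t * normal2 r' s' t' = normal3 r' s' t' * normal2 r s t.
Proof.
move=> Sr Ss St Sr' Ss' St'.
have := (normal1_rel Sr Ss St, normal2_rel Sr Ss St).
have := (normal1_rel Sr' Ss' St', normal2_rel Sr' Ss' St').
have h1 : (`|normal1 r s t| <= N ^ 6)%N by have := normal1_size r s t => ?; size_tac.
have h2 : (`|normal2 r s t| <= N ^ 5)%N by have := normal2_size r s t => ?; size_tac.
have h3 : (`|normal3 r s t| <= N ^ 4)%N by have := normal3_size r s t => ?; size_tac.
have h1' : (`|normal1 r' s' t'| <= N ^ 6)%N.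
  by have := normal1_size r' s' t' => ?; size_tac.
have h2' : (`|normal2 r' s' t'| <= N ^ 5)%N.
  by have := normal2_size r' s' t' => ?; size_tac.
have h3' : (`|normal3 r' s' t'| <= N ^ 4)%N.
  by have := normal3_size r' s' t' => ?; size_tac.
move: (normal1 r s t) (normal2 r s t) (normal3 r s t) (normal1 r' s' t')
  (normal2 r' s' t') (normal3 r' s' t') h1 h2 h3 h1' h2' h3'.
move=> a b c a' b' c' h1 h2 h3 h1' h2' h3' [Ea' Eb'] [Ea Eb].
split; apply/eqP; rewrite -subr_eq0; apply/eqP/intr_Fp_eq0; try size_tac;
  by rewrite intrB !intrM (Ea, Eb) (Ea', Eb'); ring.
Qed.

Lemma plane_rel (r s t x : triple) :
  r \in recip_triples -> s \in recip_triples -> t \in recip_triples ->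
  x \in recip_triples ->
  normal3 r s t * diff3 r x + normal2 r s t * diff2 r x
  + normal1 r s t * diff1 r x = 0.
Proof.
move=> Sr Ss St Sx.
have h1 : (`|normal1 r s t| <= N ^ 6)%N by have := normal1_size r s t => ?; size_tac.
have h2 : (`|normal2 r s t| <= N ^ 5)%N by have := normal2_size r s t => ?; size_tac.
have h3 : (`|normal3 r s t| <= N ^ 4)%N by have := normal3_size r s t => ?; size_tac.
have := (normal1_rel Sr Ss St, normal2_rel Sr Ss St, diff_rel Sr Sx).
have := diff1_size r x; have := diff2_size r x; have := diff3_size r x.
move: (normal1 r s t) (normal2 r s t) (normal3 r s t) (diff1 r x) (diff2 r x)
  (diff3 r x) h1 h2 h3.
move=> a b c a' b' c' h1 h2 h3 h1' h2' h3' [[Ea Eb] Ec'].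
apply: intr_Fp_eq0; last by size_tac.
by rewrite !(intrD, intrM) Ea Eb Ec'; ring.
Qed.

(** Parallel vectors have the same ratio of components; the form without quotients covers
    [x' = 0]. *)
Lemma parallel_leq (x y x' y' : int) (a b : nat) : x != 0 ->
  x * y' = x' * y -> (`|y| * a <= `|x| * b)%N -> (`|y'| * a <= `|x'| * b)%N.
Proof.
rewrite -absz_gt0 => x0 /(congr1 absz); rewrite !abszM => E le.
by rewrite -(leq_pmul2l x0) mulnA E -mulnA [leqRHS]mulnCA leq_mul2l le orbT.
Qed.

Lemma leq_same_bin (k a b : nat) : (0 < k)%N -> (a %/ k = b %/ k)%N ->
  (`|a%:Z - b%:Z| <= k)%N.
Proof.
move=> k0 E; rewrite (divn_eq a k) (divn_eq b k) E.
by have := ltn_pmod a k0; have := ltn_pmod b k0; lia.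
Qed.

Lemma esym_ge0 (t : triple) : esym1 t = `|esym1 t|%:Z /\ esym2 t = `|esym2 t|%:Z.
Proof.
by rewrite /esym1 /esym2; split; rewrite gez0_abs // ?addr_ge0 ?mulr_ge0.
Qed.

(** * Three close non-collinear points *)

Section SmallNormal.

Variable h : nat.
Hypotheses (h_gt0 : (0 < h)%N)
  (many : (((3 * N) %/ h).+1 * (8 * T ^ 3) < #|recip_triples|)%N).

Let N_gt0 : (0 < N)%N.
Proof. exact: leq_trans N_ge1000. Qed.

(** Among the bins of width [k], one holds more than [8 T ^ 3] triples, too many for a line. *)
Lemma close_triples (g : triple -> int) (k : nat) : (0 < k)%N ->
  (forall t, g t = `|g t|%:Z) ->
  (forall t, `|g t| %/ k <= (3 * N) %/ h)%N ->
  exists r s t, [/\ r \in recip_triples, s \in recip_triples,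
    t \in recip_triples, normal3 r s t != 0 &
    (`|(g s - g r)%R| <= k)%N /\ (`|(g t - g r)%R| <= k)%N].
Proof.
move=> k0 g0 gk.
have [i _ lt] : exists2 i, i \in iota 0 ((3 * N) %/ h).+1 &
    (8 * T ^ 3 < #|[set t in recip_triples | (`|g t| %/ k)%N == i]|)%N.
  apply: large_fiber; last by rewrite size_iota.
  by move=> t _; rewrite mem_iota add0n ltnS gk.
have [|r [s [t []]]] := noncollinear _ lt.
  by apply/subsetP => t; rewrite inE => /andP [].
rewrite !inE => /andP [Sr /eqP Er] /andP [Ss /eqP Es] /andP [St /eqP Et] n3.
exists r, s, t; rewrite !inE; split => //; rewrite (g0 r) (g0 s) (g0 t).
by split; apply: leq_same_bin => //; rewrite ?Es ?Et Er.
Qed.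

(** The trivial bounds for the three components have order [N ^ 3], [N ^ 4], [N ^ 5]. The gain of a
    factor of order [N / h] in each will make the discriminant smaller than [p]. *)
Lemma small_normal : exists r s t, [/\ [/\ r \in recip_triples,
    s \in recip_triples & t \in recip_triples], normal3 r s t != 0,
    (`|normal3 r s t| <= 12 * h * N ^ 2)%N,
    (`|normal2 r s t| <= 12 * h * N ^ 3)%N &
    (`|normal1 r s t| <= 12 * h * N ^ 4)%N].
Proof.
have many' : (8 * T ^ 3 < #|recip_triples|)%N.
  by apply: leq_ltn_trans many; rewrite mulSn leq_addr.
have [r0 [s0 [t0 [Sr0 Ss0 St0 n30]]]] := noncollinear (subxx _) many'.
set n1 := normal1 r0 s0 t0; set n2 := normal2 r0 s0 t0.
set n3 := normal3 r0 s0 t0 in n30.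
have par r s t : r \in recip_triples -> s \in recip_triples ->
    t \in recip_triples ->
    n3 * normal1 r s t = normal3 r s t * n1 /\
    n3 * normal2 r s t = normal3 r s t * n2 /\
    n1 * normal2 r s t = normal1 r s t * n2.
  move=> Sr Ss St; have [E1 E2] := normal_parallel Sr0 Ss0 St0 Sr Ss St.
  do 2!split => //; apply: (mulfI n30); rewrite -/n3 in E1 E2.
  transitivity (n1 * (n3 * normal2 r s t)); first by ring.
  by rewrite E2 mulrA [RHS]mulrA E1 -/n1 -/n2; ring.
have bins1 t : (`|esym1 t| %/ h <= (3 * N) %/ h)%N.
  by apply: leq_div2r; have := esym1_size t; rewrite expn1.
(* Width [h N] for values up to [3 N ^ 2] gives as many bins as width [h] for values up to [3 N]. *)
have bins2 t : (`|esym2 t| %/ (h * N) <= (3 * N) %/ h)%N.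
  rewrite -[leqRHS](divnMr N_gt0) -mulnA mulnn; apply: leq_div2r; exact: esym2_size.
have [r1 [s1 [t1 [Sr1 Ss1 St1 n31 [ds1 dt1]]]]] :=
  close_triples h_gt0 (fun t => proj1 (esym_ge0 t)) bins1.
(* Each product in [normal3] and [normal2] has a factor [diff1], here at most [h]; [normal1] has
   none and is handled by the case distinction below. *)
have le31 : (`|normal3 r1 s1 t1| <= 12 * h * N ^ 2)%N.
  have -> : (12 * h * N ^ 2 = h * (6 * N ^ 2) + 6 * N ^ 2 * h)%N by ring.
  exact: absz_leD (absz_leM ds1 (diff2_size _ _))
    (absz_leN (absz_leM (diff2_size _ _) dt1)).
have le21 : (`|normal2 r1 s1 t1| <= 12 * h * N ^ 3)%N.
  apply: (@leq_trans (2 * N ^ 3 * h + h * (2 * N ^ 3))).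
    exact: absz_leD (absz_leM (diff3_size _ _) dt1)
      (absz_leN (absz_leM ds1 (diff3_size _ _))).
  have -> : (2 * N ^ 3 * h + h * (2 * N ^ 3) = 4 * h * N ^ 3)%N by ring.
  by do 2!apply: leq_mul.
have [E1 [E2 E12]] := par _ _ _ Sr1 Ss1 St1.
have N4 : (12 * h * N ^ 4 = 12 * h * N ^ 3 * N)%N by ring.
have N42 : (12 * h * N ^ 4 = 12 * h * N ^ 2 * N ^ 2)%N by ring.
have N3 : (12 * h * N ^ 3 = 12 * h * N ^ 2 * N)%N by ring.
(* All normals are parallel, so the component which is the largest one relative
   to the scale (N ^ 2, N, 1) is the same for all of them.  It is made small by
   taking points with close values of esym1 (or of esym2, if it is normal1). *)
have [le13|/ltnW le31'] := leqP `|n1| (`|n3| * N ^ 2).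
  exists r1, s1, t1; split=> //.
  have := parallel_leq (a := 1) n30 E1; rewrite muln1 => /(_ _ le13).
  by rewrite muln1 => /leq_trans; apply; rewrite N42 leq_mul2r le31 orbT.
have [le12|/ltnW le21'] := leqP `|n1| (`|n2| * N).
  have n20 : n2 != 0.
    have : (0 < `|n1|)%N.
      by apply: leq_trans le31'; rewrite muln_gt0 absz_gt0 n30 expn_gt0 N_gt0.
    by move/leq_trans => /(_ _ le12); rewrite muln_gt0 absz_gt0 => /andP [].
  exists r1, s1, t1; split=> //.
  have E : n2 * normal1 r1 s1 t1 = normal2 r1 s1 t1 * n1.
    by rewrite mulrC -E12 mulrC.
  have := parallel_leq (a := 1) n20 E; rewrite muln1 => /(_ _ le12).
  by rewrite muln1 => /leq_trans; apply; rewrite N4 leq_mul2r le21 orbT.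
have n10 : n1 != 0.
  rewrite -absz_gt0; apply: leq_trans le31'.
  by rewrite muln_gt0 absz_gt0 n30 expn_gt0 N_gt0.
have hN_gt0 : (0 < h * N)%N by rewrite muln_gt0 h_gt0.
have [r2 [s2 [t2 [Sr2 Ss2 St2 n32 [ds2 dt2]]]]] :=
  close_triples hN_gt0 (fun t => proj2 (esym_ge0 t)) bins2.
have le1 : (`|normal1 r2 s2 t2| <= 12 * h * N ^ 4)%N.
  apply: (@leq_trans (h * N * (2 * N ^ 3) + 2 * N ^ 3 * (h * N))).
    exact: absz_leD (absz_leM ds2 (diff3_size _ _))
      (absz_leN (absz_leM (diff3_size _ _) dt2)).
  have -> : (h * N * (2 * N ^ 3) + 2 * N ^ 3 * (h * N) = 4 * h * N ^ 4)%N by ring.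
  by do 2!apply: leq_mul.
have [F1 [F2 F12]] := par _ _ _ Sr2 Ss2 St2.
exists r2, s2, t2; split=> //.
  have E : n1 * normal3 r2 s2 t2 = normal1 r2 s2 t2 * n3 by rewrite mulrC -F1 mulrC.
  have := parallel_leq (b := 1) n10 E; rewrite muln1 => /(_ _ le31').
  rewrite muln1 => /leq_trans /(_ le1).
  by rewrite N42 leq_pmul2r // expn_gt0 N_gt0.
have := parallel_leq (b := 1) n10 F12; rewrite muln1 => /(_ _ le21').
rewrite muln1 => /leq_trans /(_ le1).
by rewrite N4 leq_pmul2r.
Qed.

End SmallNormal.

(** * Lifting the equation to the integers *)

Lemma intr_Fp_neq0 (z : int) : z != 0 -> (`|z| <= N ^ 15)%N ->
  z%:~R != 0 :> 'F_p.
Proof. by move=> z0 zN; apply: contraNneq z0 => /intr_Fp_eq0 ->. Qed.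

(** In the lift constructed below, modulo [p], [r + q i] is [q] times [elt i] and [beta] is
    [q a / lam]; so the two conditions on all [i] reflect [elt i != 0] and [lam != (elt i)^-1]. *)
Definition lifted (a beta q r : int) : Prop :=
  [/\ [/\ a != 0, beta != 0, q != 0 & coprimez q r],
      forall i : 'I_N, r + q * (i : nat)%:Z != 0,
      forall i : 'I_N, a * (r + q * (i : nat)%:Z) != beta,
      forall t, t \in recip_triples ->
        let x := r + q * (t.1.1 : nat)%:Z in
        let y := r + q * (t.1.2 : nat)%:Z in
        let z := r + q * (t.2 : nat)%:Z in
        a * (x * y * z) = beta * (x * y + x * z + y * z) &
      [/\ (`|a| <= N ^ 3)%N, (`|beta| <= N ^ 15)%N, (`|q| <= N ^ 9)%N &
          (`|r| <= N ^ 11)%N]].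

Lemma exists_lift (h : nat) : (0 < h)%N -> (12 * h <= N)%N ->
  (128 * (12 * h * N ^ 2) ^ 4 * N ^ 6 < p)%N ->
  (((3 * N) %/ h).+1 * (8 * T ^ 3) < #|recip_triples|)%N ->
  exists a beta q r, lifted a beta q r.
Proof.
move=> h_gt0 hN lt_p many.
have [x0 [x1 [x2 [[S0 S1 S2] n30 le3 le2 le1]]]] := small_normal h_gt0 many.
have rel t := plane_rel S0 S1 S2 (x := t).
have := (normal1_rel S0 S1 S2, normal2_rel S0 S1 S2).
move: (normal3 x0 x1 x2) (normal2 x0 x1 x2) (normal1 x0 x1 x2) n30 le3 le2 le1 rel.
move=> a b c a0 ha hb hc rel [Ec Eb].
(* The constant term of the integer equation [a s3 + b s2 + c s1 + d = 0] of the plane. *)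
pose d := - (a * esym3 x0 + b * esym2 x0 + c * esym1 x0).
have hd : (`|d| <= 7 * (12 * h * N ^ 2) * N ^ 3)%N.
  have -> : (7 * (12 * h * N ^ 2) * N ^ 3 = 12 * h * N ^ 2 * (1 * N ^ 3)
    + 12 * h * N ^ 3 * (3 * N ^ 2) + 12 * h * N ^ 4 * (3 * N ^ 1))%N by ring.
  exact: absz_leN (absz_leD (absz_leD (absz_leM ha (esym3_size _))
    (absz_leM hb (esym2_size _))) (absz_leM hc (esym1_size _))).
have Ed : d%:~R = rel0 * a%:~R :> 'F_p.
  rewrite /d; have := esym_rel S0.
  move: (esym1 x0) (esym2 x0) (esym3 x0) => e1 e2 e3 E.
  by rewrite intrN !intrD !intrM E Eb Ec; ring.
have a0p : a%:~R != 0 :> 'F_p.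
  apply: intr_Fp_neq0 => //; apply: leq_trans ha _.
  apply: (@leq_trans (N * N ^ 2)); first by rewrite leq_mul2r hN orbT.
  by rewrite -expnS leq_pexp2l // (leq_trans _ N_ge1000).
pose mu := lam^-1; have mu0 : mu != 0 by rewrite invr_eq0.
pose m : 'F_p := M%:~R; pose H := b ^+ 2 - a * c.
have EH : H%:~R = a%:~R ^+ 2 * mu ^+ 2 :> 'F_p.
  by rewrite /H intrB !intrM Eb Ec /rel2 /rel1 -/mu -/m; ring.
have Er : (b * c - a * d)%:~R = m * (2%:R * H)%:~R :> 'F_p.
  rewrite intrM EH intrB !intrM Eb Ec Ed /rel2 /rel1 /rel0 -/mu -/m; ring.
(* The difference of the two sides is the discriminant of the cubic, up to a constant factor. It
   vanishes modulo [p] because of the double root [- M], and it is smaller than [p] by [lt_p]. *)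
have disc0 : 4%:R * H * (c ^+ 2 - b * d) = (b * c - a * d) ^+ 2.
  apply/eqP; rewrite -subr_eq0; apply/eqP; apply: intr_Fp_small.
    rewrite intrB expr2 !intrM EH intrB !intrM intrB !intrM Eb Ec Ed.
    by rewrite /rel2 /rel1 /rel0 -/mu -/m; ring.
  apply: leq_ltn_trans lt_p; set K := (12 * h * N ^ 2)%N in hd ha *.
  have EK3 : (12 * h * N ^ 3 = K * N)%N by rewrite /K; ring.
  have EK4 : (12 * h * N ^ 4 = K * N ^ 2)%N by rewrite /K; ring.
  rewrite EK3 in hb; rewrite EK4 in hc.
  (* The factors are at most [2 K^2 N^2], [8 K^2 N^4] and [8 K^2 N^3], whence
     [128 = 4 * 2 * 8 + 8 * 8]. *)
  have -> : (128 * K ^ 4 * N ^ 6 =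
      4 * (K * N * (K * N) + K * (K * N ^ 2))
        * (K * N ^ 2 * (K * N ^ 2) + K * N * (7 * K * N ^ 3))
      + (K * N * (K * N ^ 2) + K * (7 * K * N ^ 3))
        * (K * N * (K * N ^ 2) + K * (7 * K * N ^ 3)))%N by ring.
  rewrite !expr2; apply: absz_leD; [apply: absz_leM|apply/absz_leN/absz_leM].
  - by apply: absz_leM => //; apply/(absz_leD (absz_leM hb hb))/absz_leN/absz_leM.
  - by apply/(absz_leD (absz_leM hc hc))/absz_leN/absz_leM.
  - by apply/(absz_leD (absz_leM hb hc))/absz_leN/absz_leM.
  - by apply/(absz_leD (absz_leM hb hc))/absz_leN/absz_leM.
have [R1 R2] := double_root disc0.
have H2p : (2%:R * H)%:~R != 0 :> 'F_p.
  rewrite intrM EH; apply: mulf_neq0; last by rewrite mulf_neq0 // expf_neq0.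
  by apply: intr_Fp_neq0 => //; size_tac.
have Q0 : 2%:R * H != 0 by apply: contraNneq H2p => ->.
(* The double root [- r / q] in lowest terms; coprimality later makes the gcds of the numbers
   [r + q i] divide differences of indices. *)
have [g [q [r [Eq Er' g0 q0 cop]]]] : exists g q r : int, [/\ 2%:R * H = g * q,
    b * c - a * d = g * r, g != 0, q != 0 & coprimez q r].
  by do 3!eexists; apply: divz_gcd_spec.
rewrite -/H Er' Eq in R1 R2.
have qp : q%:~R != 0 :> 'F_p.
  by apply: contraNneq H2p => q0p; rewrite Eq intrM q0p mulr0.
have rq : r%:~R = m * q%:~R :> 'F_p.
  have gp : g%:~R != 0 :> 'F_p.
    by apply: contraNneq H2p => g0p; rewrite Eq intrM g0p mul0r.
  by apply: (mulfI gp); rewrite -intrM -Er' Er Eq intrM mulrCA.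
have {}R1 : a * r ^+ 2 - 2%:R * b * r * q + c * q ^+ 2 = 0.
  by apply: (mulfI (expf_neq0 2 g0)); rewrite mulr0 -[RHS]R1; ring.
have {}R2 : b * r ^+ 2 - 2%:R * c * r * q + d * q ^+ 2 = 0.
  by apply: (mulfI (expf_neq0 2 g0)); rewrite mulr0 -[RHS]R2; ring.
have xp (i : 'I_N) : (r + q * (i : nat)%:Z)%:~R = q%:~R * elt i :> 'F_p.
  by rewrite intrD intrM rq /elt intrD -/m; ring.
have betap : (a * r - b * q)%:~R = q%:~R * a%:~R * mu :> 'F_p.
  by rewrite intrB !intrM rq Eb /rel2 -/mu -/m; ring.
exists a, (a * r - b * q), q, r; split.
- split=> //; apply: contraNneq (mulf_neq0 (mulf_neq0 qp a0p) mu0) => E.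
  by rewrite -betap E.
- by move=> i; apply: contraNneq (mulf_neq0 qp (elt_neq0 i)) => E; rewrite -xp E.
- move=> i; apply: contraNneq (lamB_neq0 i) => E.
  have : q%:~R * a%:~R * elt i = q%:~R * a%:~R * mu :> 'F_p.
    by rewrite -betap -E intrM xp; ring.
  by move/(mulfI (mulf_neq0 qp a0p)) => ->; rewrite /mu invrK subrr.
- move=> t St; apply: (double_root_shift R1 R2).
  have := rel t St; rewrite /d /diff1 /diff2 /diff3 => E.
  by rewrite -[RHS]E /esym1 /esym2 /esym3; ring.
- have hNX k : (12 * h * N ^ k <= N ^ k.+1)%N by rewrite expnS leq_mul2r hN orbT.
  have {}ha := leq_trans ha (hNX 2); have {}hb := leq_trans hb (hNX 3).
  have {}hc := leq_trans hc (hNX 4).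
  have {}hd : (`|d| <= 7 * N ^ 6)%N.
    apply: leq_trans hd _; rewrite -mulnA leq_mul2l /=.
    by rewrite [X in (_ <= X)%N](expnD N 3 3) leq_mul2r hNX orbT.
  have g_gt0 : (0 < `|g|)%N by rewrite absz_gt0.
  have hq : (`|q| <= N ^ 9)%N.
    apply: (@leq_trans `|g * q|); first by rewrite abszM leq_pmull.
    by rewrite -Eq /H expr2; size_tac.
  have hr : (`|r| <= N ^ 11)%N.
    apply: (@leq_trans `|g * r|); first by rewrite abszM leq_pmull.
    by rewrite -Er'; size_tac.
  by split=> //; size_tac.
Qed.

Lemma card_same_coord (A : {set triple}) (f : triple -> 'I_N) :
  A \subset recip_triples -> (forall t, f t \in coords t) ->
  {in A &, forall s t, f s = f t} -> (#|A| <= 3 * T)%N.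
Proof.
move=> /subsetP subA fc fA; have [->|[s As]] := set_0Vmem A.
  by rewrite cards0.
apply: leq_trans (card_recip_triples_coord (f s)).
by apply/subset_leq_card/subsetP => t At; rewrite inE subA // (fA s t) ?fc.
Qed.

(** * Counting solutions of the lifted equation *)

Section Count.

Variables a b q r : int.
Hypothesis lift : lifted a b q r.

Let a0 : a != 0. Proof. by case: lift => [[]]. Qed.
Let b0 : b != 0. Proof. by case: lift => [[]]. Qed.
Let q0 : q != 0. Proof. by case: lift => [[]]. Qed.
Let cop : coprimez q r. Proof. by case: lift => [[]]. Qed.
Let ha : (`|a| <= N ^ 3)%N. Proof. by case: lift => [_ _ _ _ []]. Qed.
Let hb : (`|b| <= N ^ 15)%N. Proof. by case: lift => [_ _ _ _ []]. Qed.
Let hq : (`|q| <= N ^ 9)%N. Proof. by case: lift => [_ _ _ _ []]. Qed.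
Let hr : (`|r| <= N ^ 11)%N. Proof. by case: lift => [_ _ _ _ []]. Qed.

Let X (i : 'I_N) : int := r + q * (i : nat)%:Z.

Let X_neq0 i : X i != 0. Proof. by case: lift => [_ + _ _ _]; apply. Qed.

Let X_size i : (`|X i| <= N ^ 12)%N.
Proof. by have hi := ord_size i; rewrite /X; size_tac. Qed.

Let X_inj : injective X.
Proof. by move=> i j /addrI /(mulfI q0) [] /val_inj. Qed.

(** The selectors [f], [g], [k] let one statement serve two pairs of coordinates. Two factors [T]
    count [w] and [a X - b]; then one coordinate is known and at most [3 T] triples remain. *)
Lemma card_gcd_eq (f g k : triple -> 'I_N) (h : nat) :
  (forall t, f t \in coords t) ->
  (forall t, t \in recip_triples ->
     a * (X (f t) * X (g t) * X (k t)) =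
     b * (X (f t) * X (g t) + X (f t) * X (k t) + X (g t) * X (k t))) ->
  (#|[set t in recip_triples | `|gcdz (X (f t)) (X (g t))|%N == h]|
     <= 3 * T ^ 3)%N.
Proof.
move=> fc rel; set A := [set t in _ | _].
have -> : (3 * T ^ 3 = T * (T * (3 * T)))%N by ring.
pose G t := gcdz (X (f t)) (X (g t)).
pose x1 t := (X (f t) %/ G t)%Z; pose y1 t := (X (g t) %/ G t)%Z.
have spec t : [/\ X (f t) = G t * x1 t, X (g t) = G t * y1 t, G t != 0,
    x1 t != 0 & coprimez (x1 t) (y1 t)] := divz_gcd_spec _ (X_neq0 (f t)).
have leM (x y z : int) : x = y * z -> x != 0 -> (`|y| <= `|x|)%N /\ (`|z| <= `|x|)%N.
  move=> -> /[dup]; rewrite {1}mulf_eq0 negb_or => /andP [y0 z0] _.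
  by rewrite abszM leq_pmulr ?leq_pmull ?absz_gt0.
have [A0|[t0 At0]] := set_0Vmem A; first by rewrite A0 cards0.
have GA t : t \in A -> G t = h%:Z.
  by rewrite inE => /andP [_ /eqP <-]; rewrite gez0_abs.
have h_size : (`|h%:Z| <= N ^ 12)%N.
  rewrite -(GA _ At0); have [E _ _ _ _] := spec t0.
  exact: leq_trans (proj1 (leM _ _ _ E (X_neq0 _))) (X_size _).
have h0 : h%:Z != 0 by rewrite -(GA _ At0); have [] := spec t0.
(* 1/z = w / (b h x1 y1), where w is coprime to x1 y1 up to divisors of b; for a
   fixed value k0 of w, [a h k0 + b ^ 2 = (a x - b) (a y - b)]. *)
pose w t := a * h%:Z * x1 t * y1 t - b * (x1 t + y1 t).
have z0 : b ^+ 3 * h%:Z != 0 by rewrite mulf_neq0 ?expf_neq0.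
apply: (leq_card_divisors (f := w) z0).
- by rewrite !exprS expr0 mulr1; size_tac.
- move=> t At; have [Ex Ey _ _ co] := spec t; rewrite (GA _ At) in Ex Ey.
  move: (At); rewrite inE => /andP [St _].
  exact: (gcd_dvd (X_neq0 _) (rel t St) Ex Ey co).
move=> k0; set B := [set t in A | _].
have [B0|[t1 Bt1]] := set_0Vmem B; first by rewrite B0 cards0.
have subB : B \subset A by apply/subsetP => t; rewrite inE => /andP [].
have Bfac t : t \in B ->
    a * h%:Z * k0 + b ^+ 2 = (a * X (f t) - b) * (a * X (g t) - b).
  rewrite inE => /andP [At /eqP <-]; have [-> -> _ _ _] := spec t.
  by rewrite (GA _ At) /w; ring.
have z1 : a * h%:Z * k0 + b ^+ 2 != 0.
  rewrite (Bfac _ Bt1); case: lift => [_ _ ne _ _].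
  by rewrite mulf_neq0 // subr_eq0 ne.
apply: (leq_card_divisors (f := fun t => a * X (f t) - b) z1).
- have [Ex Ey _ _ _] := spec t1.
  have hx := leq_trans (proj2 (leM _ _ _ Ex (X_neq0 _))) (X_size _).
  have hy := leq_trans (proj2 (leM _ _ _ Ey (X_neq0 _))) (X_size _).
  move: Bt1; rewrite inE => /andP [_ /eqP <-].
  by rewrite /w expr2; size_tac.
- by move=> t Bt; rewrite (Bfac t Bt) dvdz_mulr.
move=> k1; apply: (card_same_coord (f := f)) => //.
  apply/subsetP => t; rewrite !inE => /andP [/andP [/andP [-> _] _] _] //.
move=> s t; rewrite !(inE, andbA) => /andP [_ /eqP Es] /andP [_ /eqP Et].
apply/X_inj/(mulfI a0); apply: (addIr (- b)); exact: etrans Es (esym Et).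
Qed.

Let G (i j : 'I_N) : int := gcdz (X i) (X j).

(** [G i j] divides [X i - X j = q (i - j)], and it is coprime to [q] since [X i] is congruent to
    [r] modulo [q]. *)
Let gcd_dvd_diff (i j : 'I_N) : (G i j %| (i : nat)%:Z - (j : nat)%:Z)%Z.
Proof.
have copX : coprimez (G i j) q.
  rewrite coprimezE; apply: (@coprime_dvdl _ `|X i|); first exact: dvdz_gcdl.
  by rewrite -coprimezE coprimez_sym /coprimez /X addrC mulrC gcdzMDl.
rewrite -(Gauss_dvdzr _ copX).
have -> : q * ((i : nat)%:Z - (j : nat)%:Z) = X i - X j by rewrite /X; ring.
by rewrite rpredB ?dvdz_gcdl ?dvdz_gcdr.
Qed.

Let quot (i j : 'I_N) : int := (((i : nat)%:Z - (j : nat)%:Z) %/ G i j)%Z.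

Let quotE (i j : 'I_N) : (i : nat)%:Z - (j : nat)%:Z = G i j * quot i j.
Proof. by rewrite mulrC divzK. Qed.

Let quot_size (i j : 'I_N) (H0 : nat) : (0 < H0)%N -> (H0 < `|G i j|)%N ->
  (`|quot i j| <= N %/ H0)%N.
Proof.
move=> H0_gt0 ltG; rewrite leq_divRL //.
apply: (@leq_trans (`|quot i j| * `|G i j|)); first by rewrite leq_mul2l ltnW ?orbT.
by rewrite mulnC -abszM -quotE; have := ltn_ord i; have := ltn_ord j; lia.
Qed.

(** Three factors [T] count [y'] and [z'], which divide [b], and then [e], which divides
    [b q (k2 y' + k3 z')]. The last number is nonzero because [a X = 3 b] is excluded. These data
    determine the first coordinate. *)
Lemma card_quot_eq (k3 k2 : int) : (`|k3| <= N)%N -> (`|k2| <= N)%N ->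
  (#|[set t in recip_triples | (a * X t.1.1 != 3%:R * b)%R &&
      ((quot t.1.1 t.1.2, quot t.1.1 t.2) == (k3, k2))]| <= 3 * T ^ 4)%N.
Proof.
move=> hk3 hk2; set A := [set t in _ | _].
have -> : (3 * T ^ 4 = T * (T * (T * (3 * T))))%N by ring.
pose y1 (t : triple) := (X t.1.2 %/ G t.1.1 t.1.2)%Z.
pose z2 (t : triple) := (X t.2 %/ G t.1.1 t.2)%Z.
pose e t := gcdz (y1 t) (z2 t).
pose y' t := (y1 t %/ e t)%Z; pose z' t := (z2 t %/ e t)%Z.
have G_neq0 i j : G i j != 0.
  by have [] := divz_gcd_spec (X j) (X_neq0 i).
have main t : t \in A -> [/\ (y' t %| b)%Z, (z' t %| b)%Z,
    e t * y' t * z' t != 0 & a * X t.1.1 * (e t * y' t * z' t) =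
      b * (3%:R * (e t * y' t * z' t) + q * (k2 * y' t + k3 * z' t))].
  rewrite inE => /andP [St /andP [_ /eqP [Ek3 Ek2]]].
  have [Ex3 Ey G30 _ cop3] := divz_gcd_spec (X t.1.2) (X_neq0 t.1.1).
  have [Ex2 Ez G20 _ cop2] := divz_gcd_spec (X t.2) (X_neq0 t.1.1).
  have y1_neq0 : y1 t != 0.
    by apply: contraNneq (X_neq0 t.1.2) => E; rewrite Ey -/(y1 t) E mulr0.
  have z2_neq0 : z2 t != 0.
    by apply: contraNneq (X_neq0 t.2) => E; rewrite Ez -/(z2 t) E mulr0.
  have [Ey1 Ez2 e0 y'0 cop'] := divz_gcd_spec (z2 t) y1_neq0.
  have z'0 : z' t != 0.
    by apply: contraNneq z2_neq0 => E; rewrite Ez2 -/(z' t) E mulr0.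
  have D3 : (X t.1.1 %/ G t.1.1 t.1.2)%Z - y1 t = q * k3.
    apply: (mulfI G30); rewrite mulrBr -Ex3 -Ey -Ek3 mulrCA -quotE /X; ring.
  have D2 : (X t.1.1 %/ G t.1.1 t.2)%Z - z2 t = q * k2.
    apply: (mulfI G20); rewrite mulrBr -Ex2 -Ez -Ek2 mulrCA -quotE /X; ring.
  case: lift => [_ _ _ rel _].
  have [dy dz E] := reciprocals_param (X_neq0 _) (X_neq0 _) (rel t St)
    Ex3 Ey cop3 Ex2 Ez cop2 Ey1 Ez2 cop' D3 D2.
  by split=> //; rewrite !mulf_neq0.
have b_size : (`|b| <= N ^ 60)%N by size_tac.
apply: (leq_card_divisors (f := y') b0 b_size); first by move=> t /main [].
move=> y; apply: (leq_card_divisors (f := z') b0 b_size).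
  by move=> t; rewrite inE => /andP [/main []].
move=> z; set B := [set t in _ | _].
have BA t : t \in B -> [/\ t \in A, y' t = y & z' t = z].
  by rewrite !(inE, andbA) => /andP [/andP [-> /eqP ->] /eqP ->].
have [B0|[t0 Bt0]] := set_0Vmem B; first by rewrite B0 cards0.
pose d := b * q * (k2 * y + k3 * z).
have BE t : t \in B -> (a * X t.1.1 - 3%:R * b) * (e t * y * z) = d.
  move=> /BA [/main [_ _ _ E] Ey Ez]; rewrite Ey Ez in E.
  by rewrite mulrBl E /d; ring.
have d0 : d != 0.
  have [At0 Ey Ez] := BA _ Bt0; have [_ _ ne _] := main _ At0.
  rewrite Ey Ez in ne; rewrite -(BE _ Bt0) mulf_neq0 // subr_eq0.
  by move: At0; rewrite inE => /andP [_ /andP []].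
have dN : (`|d| <= N ^ 60)%N.
  have [At0 Ey Ez] := BA _ Bt0; have [dy dz _ _] := main _ At0.
  rewrite Ey in dy; rewrite Ez in dz.
  have hy : (`|y| <= N ^ 15)%N.
    by apply: leq_trans hb; apply: dvdn_leq; rewrite ?absz_gt0.
  have hz : (`|z| <= N ^ 15)%N.
    by apply: leq_trans hb; apply: dvdn_leq; rewrite ?absz_gt0.
  have {}hk3 : (`|k3| <= N ^ 1)%N by rewrite expn1.
  have {}hk2 : (`|k2| <= N ^ 1)%N by rewrite expn1.
  by clear b_size; rewrite /d; size_tac.
apply: (leq_card_divisors (f := e) d0 dN).
  move=> t Bt; rewrite -(BE t Bt).
  have -> : (a * X t.1.1 - 3%:R * b) * (e t * y * z) =
    e t * ((a * X t.1.1 - 3%:R * b) * y * z) by ring.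
  exact: dvdz_mulr.
move=> e1; apply: (card_same_coord (f := fun t => t.1.1)).
- by apply/subsetP => t; rewrite inE => /andP [/BA [+ _ _] _]; rewrite inE => /andP [].
- by move=> t; rewrite inE eqxx.
move=> s t; rewrite inE => /andP [Bs /eqP Es]; rewrite inE => /andP [Bt /eqP Et].
have ne : e1 * y * z != 0.
  by have [As <- <-] := BA _ Bs; have [_ _ + _] := main _ As; rewrite Es.
apply/X_inj/(mulfI a0); apply: (addIr (- (3%:R * b))); apply: (mulIf ne).
by rewrite -{1}Es -{1}Et BE // BE.
Qed.

(** [H0] separates small from large gcds. Small ones are counted by their value, for either pair; if
    both are large, the two quotients are at most [N / H0] in absolute value and are counted
    jointly. The middle term is for the exceptional value [a X = 3 b]. *)
Lemma card_lift (H0 : nat) : (0 < H0)%N ->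
  (#|recip_triples| <= 2 * (H0.+1 * (3 * T ^ 3)) + 3 * T
     + (2 * (N %/ H0)).+1 ^ 2 * (3 * T ^ 4))%N.
Proof.
move=> H0_gt0; case: lift => [_ _ _ rel _].
pose A1 := [set t in recip_triples | (`|G t.1.1 t.1.2| <= H0)%N].
pose A2 := [set t in recip_triples | (`|G t.1.1 t.2| <= H0)%N].
pose A3 := [set t in recip_triples | a * X t.1.1 == 3%:R * b].
pose A4 := [set t in recip_triples | [&& a * X t.1.1 != 3%:R * b,
  (H0 < `|G t.1.1 t.1.2|)%N & (H0 < `|G t.1.1 t.2|)%N]].
have cover : recip_triples \subset A1 :|: A2 :|: A3 :|: A4.
  apply/subsetP => t St; rewrite !inE in St *; rewrite St /= !ltnNge.
  by case: (_ <= _)%N; case: (_ <= _)%N; case: (_ == _).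
apply: leq_trans (subset_leq_card cover) _.
have cardU (B C : {set triple}) (k l : nat) :
    (#|B| <= k -> #|C| <= l -> #|B :|: C| <= k + l)%N.
  by move=> hB hC; apply: leq_trans (leq_card_setU _ _) (leq_add hB hC).
apply: (cardU); last first.
  pose B := (N %/ H0)%N; pose zr := [seq i%:Z - B%:Z | i <- iota 0 (2 * B).+1].
  have BN : (B <= N)%N by apply: leq_div.
  have sz : size [seq (k, l) | k <- zr, l <- zr] = ((2 * B).+1 ^ 2)%N.
    by rewrite (size_allpairs pair) size_map size_iota mulnn.
  rewrite -sz; apply: (leq_card_fibers
    (f := fun t : triple => (quot t.1.1 t.1.2, quot t.1.1 t.2))).
    move=> t; rewrite inE => /andP [_ /and3P [_ g3 g2]].
    by apply/allpairsP; exists (quot t.1.1 t.1.2, quot t.1.1 t.2);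
      rewrite !mem_zrange !quot_size.
  move=> _ /allpairsP [[k l] /= [+ + ->]]; rewrite !mem_zrange => hk hl.
  apply: leq_trans (card_quot_eq (leq_trans hk BN) (leq_trans hl BN)).
  apply/subset_leq_card/subsetP => t; rewrite !inE.
  by move=> /andP [/andP [-> /and3P [-> _ _]] ->].
apply: (cardU _ _ _ (3 * T)%N); last first.
  apply: (card_same_coord (f := fun t => t.1.1)).
  - by apply/subsetP => t; rewrite inE => /andP [].
  - by move=> t; rewrite inE eqxx.
  move=> s t; rewrite !inE => /andP [_ /eqP Es] /andP [_ /eqP Et].
  by apply/X_inj/(mulfI a0); rewrite Es Et.
have small (f g k : triple -> 'I_N) : (forall t, f t \in coords t) ->
    (forall t, t \in recip_triples ->
      a * (X (f t) * X (g t) * X (k t)) =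
      b * (X (f t) * X (g t) + X (f t) * X (k t) + X (g t) * X (k t))) ->
    (#|[set t in recip_triples | (`|G (f t) (g t)| <= H0)%N]|
      <= H0.+1 * (3 * T ^ 3))%N.
  move=> fc fgk; rewrite -[X in (_ <= X * _)%N](size_iota 0).
  apply: (leq_card_fibers (f := fun t => `|G (f t) (g t)|%N)).
    by move=> t; rewrite inE mem_iota add0n ltnS => /andP [].
  move=> h _; apply: leq_trans (card_gcd_eq h fc fgk).
  by apply/subset_leq_card/subsetP => t; rewrite !inE => /andP [/andP [-> _] ->].
rewrite mul2n -addnn; apply: (cardU).
  apply: (small (fun t => t.1.1) (fun t => t.1.2) (fun t => t.2)) => //.
  by move=> t; rewrite inE eqxx.
apply: (small (fun t => t.1.1) (fun t => t.2) (fun t => t.1.2)).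
  by move=> t; rewrite inE eqxx.
move=> t St; transitivity (a * (X t.1.1 * X t.1.2 * X t.2)); first by ring.
by rewrite (rel t St) /X; ring.
Qed.

End Count.

(** [m] is the integer cube root of [N]. With [h] of order [m] there are at most [2305 m ^ 2] bins;
    either the triples are too few for a lift, which gives the bound directly, or the lifted
    equation is available. *)
Lemma card_recip_triples (m : nat) : (48 <= m)%N ->
  (m ^ 3 <= N < m.+1 ^ 3)%N -> (N ^ 46 < p ^ 3)%N ->
  (#|recip_triples| <= 2305 * 8 * (T ^ 4 * m ^ 2))%N.
Proof.
move=> m_ge /andP [mN Nm] ltNp; pose h := (m %/ 48)%N.
(* 128 * 12 ^ 4 <= 48 ^ 4, so that the discriminant is at most
   (48 h) ^ 4 N ^ 14 <= N ^ (46 / 3) < p. *)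
have h_gt0 : (0 < h)%N by rewrite divn_gt0.
have le_hm : (48 * h <= m)%N by rewrite mulnC leq_divM.
have lt_mh : (m <= 96 * h)%N.
  apply: ltnW; apply: leq_trans (ltn_ceil m (ltn0Sn 47)) _.
  by rewrite -/h; clear -h_gt0; clearbody h; lia.
have m_gt0 : (0 < m)%N by apply: leq_trans m_ge.
have le_Nm : (N <= 8 * m ^ 3)%N.
  apply: ltnW; apply: leq_trans Nm _; rewrite -[8%N]/(2 ^ 3)%N -expnMn leq_exp2r //.
  by clear -m_gt0; lia.
have le_mN : (m <= N)%N by apply: leq_trans mN; rewrite -{1}(expn1 m) leq_pexp2l.
have disc : (128 * (12 * h * N ^ 2) ^ 4 * N ^ 6 < p)%N.
  rewrite ltnNge; apply/negP => le_p; move: ltNp; rewrite ltnNge => /negP [].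
  have {}le_p : (p <= (48 * h) ^ 4 * N ^ 14)%N.
    apply: leq_trans le_p _.
    have -> : (128 * (12 * h * N ^ 2) ^ 4 * N ^ 6
      = 128 * ((12 * h) ^ 4 * N ^ 14))%N by ring.
    have -> : ((48 * h) ^ 4 * N ^ 14 = 256 * ((12 * h) ^ 4 * N ^ 14))%N.
      have -> : (48 * h = 4 * (12 * h))%N by rewrite mulnA.
      by rewrite expnMn -mulnA.
    by rewrite leq_mul2r orbT.
  apply: leq_trans (_ : ((48 * h) ^ 4 * N ^ 14) ^ 3 <= _)%N; first by rewrite leq_exp2r.
  have -> : (((48 * h) ^ 4 * N ^ 14) ^ 3 = ((48 * h) ^ 3) ^ 4 * N ^ 42)%N.
    by rewrite expnMn -!expnM.
  rewrite (expnD N 4 42) leq_mul2r leq_exp2r //.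
  by rewrite (leq_trans _ mN) ?orbT // leq_exp2r.
have T_gt0 : (0 < T)%N by apply: leq_trans T_ge2.
have T34 : (T ^ 3 <= T ^ 4)%N by rewrite leq_pexp2l.
have T14 : (T <= T ^ 4)%N by rewrite -{1}(expn1 T) leq_pexp2l.
have m2_gt0 : (0 < m ^ 2)%N by rewrite expn_gt0 m_gt0.
have [few|many] := leqP #|recip_triples| (((3 * N) %/ h).+1 * (8 * T ^ 3)).
  apply: leq_trans few _.
  (* [2304 = 24 * 96] comes from [3 N <= 24 m ^ 3] and [m <= 96 h]; the extra bin is absorbed by
     [m ^ 2]. *)
  have le_bins : (((3 * N) %/ h).+1 <= 2305 * m ^ 2)%N.
    have : ((3 * N) %/ h <= 2304 * m ^ 2)%N.
      rewrite -[leqRHS](mulnK _ h_gt0); apply: leq_div2r.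
      apply: leq_trans (_ : 24 * (m ^ 2 * (96 * h)) <= _)%N.
        apply: leq_trans (_ : 24 * (m ^ 2 * m) <= _)%N.
          by rewrite -expnSr; clear -le_Nm; lia.
        by rewrite !leq_mul2l lt_mh !orbT.
      by apply: eq_leq; rewrite -[2304%N]/(24 * 96)%N; ring.
    by move=> le; apply: leq_ltn_trans le _; clear -m2_gt0; lia.
  apply: leq_trans (leq_mul le_bins (leq_mul (leqnn 8) T34)) _.
  by apply: eq_leq; ring.
have h12 : (12 * h <= N)%N.
  by apply: leq_trans le_mN; apply: leq_trans le_hm; rewrite leq_mul2r orbT.
have [a [b [q [r lift]]]] := exists_lift h_gt0 h12 disc many.
(* The choice [H0 = m ^ 2] balances the two main terms, since [(N / H0) ^ 2] also has order
   [m ^ 2]. *)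
apply: leq_trans (card_lift lift m2_gt0) _.
have le_div : (N %/ m ^ 2 <= 8 * m)%N.
  rewrite -[leqRHS](mulnK _ m2_gt0); apply: leq_div2r.
  by apply: leq_trans le_Nm _; apply: eq_leq; ring.
have le_sq : ((2 * (N %/ m ^ 2)).+1 ^ 2 <= (17 * m) ^ 2)%N.
  by rewrite leq_exp2r //; clear -le_div m_gt0; lia.
have s1 : (2 * ((m ^ 2).+1 * (3 * T ^ 3)) <= 12 * (T ^ 4 * m ^ 2))%N.
  apply: leq_trans (_ : 2 * ((2 * m ^ 2) * (3 * T ^ 4)) <= _)%N.
    by rewrite leq_mul2l /= leq_mul //; [clear -m2_gt0; lia | rewrite leq_mul2l].
  by apply: eq_leq; ring.
have s2 : (3 * T <= 3 * (T ^ 4 * m ^ 2))%N.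
  by rewrite leq_mul2l /= (leq_trans T14) // leq_pmulr.
have s3 : ((2 * (N %/ m ^ 2)).+1 ^ 2 * (3 * T ^ 4) <= 867 * (T ^ 4 * m ^ 2))%N.
  apply: leq_trans (leq_mul le_sq (leqnn _)) _.
  by apply: eq_leq; rewrite -[867%N]/(17 * 17 * 3)%N; ring.
apply: leq_trans (leq_add (leq_add s1 s2) s3) _.
by rewrite -!mulnDl leq_mul2r; apply/orP; right.
Qed.

End Interval.

(** * The theorem *)

Definition max_zdivisors (n : nat) : nat :=
  (2 * \max_(i < n.+1) size (divisors i))%N.

Lemma leq_max_zdivisors (n : nat) (z : int) : (`|z| <= n)%N ->
  (size (zdivisors z) <= max_zdivisors n)%N.
Proof.
rewrite -ltnS => le; rewrite size_zdivisors -mul2n leq_mul2l /=.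
exact: (bigop.bigmax_sup (Ordinal le)).
Qed.

Lemma max_zdivisors_ge2 (n : nat) : (0 < n)%N -> (2 <= max_zdivisors n)%N.
Proof.
by move=> n_gt0; apply: leq_trans (leq_max_zdivisors (z := 1) n_gt0).
Qed.

Lemma max_zdivisors_bound (k n : nat) : (0 < k)%N -> (0 < n)%N ->
  (max_zdivisors n ^ k <= 2 ^ k * (k ^ k) ^ (2 ^ k) * n)%N.
Proof.
move=> k_gt0 n_gt0; rewrite expnMn -mulnA leq_mul2l; apply/orP; right.
have [|i _ ->] := eq_bigmax_cond (A := predT)
  (fun i : 'I_n.+1 => size (divisors i)); first by rewrite card_ord.
(* [divisors 0] has one element, so the index 0 in the maximum is harmless. *)
have [->|i_gt0] := posnP i; last first.
  apply: leq_trans (size_divisors_bound k_gt0 i_gt0) _.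
  by rewrite leq_mul2l -ltnS ltn_ord orbT.
by rewrite exp1n muln_gt0 n_gt0 !expn_gt0 k_gt0.
Qed.

Lemma exists_cube_root (N : nat) : exists m, (m ^ 3 <= N < m.+1 ^ 3)%N.
Proof.
have ex0 : exists m, (m ^ 3 <= N)%N by exists 0%N.
have bound m : (m ^ 3 <= N)%N -> (m <= N)%N.
  by case: m => // m; apply: leq_trans; rewrite -{1}(expn1 m.+1) leq_pexp2l.
have [m mN max] := ex_maxnP ex0 bound; exists m; rewrite mN ltnNge.
by apply/negP => /max; rewrite ltnn.
Qed.

Section Real.

Variable R : realType.

(** Compare [k]-th powers: [T ^ (4 k) <= D ^ 4 N ^ 240], and [240 = 4 * 60] is at most [eps k]. *)
Lemma max_zdivisors_powR (k N : nat) (eps : R) : (0 < k)%N -> (0 < N)%N ->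
  240%:R <= eps * k%:R ->
  (max_zdivisors (N ^ 60))%:R ^+ 4
  <= ((2 ^ k * (k ^ k) ^ (2 ^ k))%N%:R) ^+ 4 * N%:R `^ eps.
Proof.
move=> k_gt0 N_gt0 le_eps; set T := max_zdivisors _; set D := (_ * _)%N.
have k0 : (0 : R) < k%:R by rewrite ltr0n.
have D_ge1 : (1 : R) <= D%:R by rewrite ler1n muln_gt0 !expn_gt0 k_gt0.
have N_ge1 : (1 : R) <= N%:R by rewrite ler1n.
have TD : T%:R ^+ k <= D%:R * N%:R ^+ 60 :> R.
  by rewrite -!natrX -natrM ler_nat max_zdivisors_bound // expn_gt0 N_gt0.
rewrite -(ler_pXn2r k_gt0) ?nnegrE ?mulr_ge0 ?exprn_ge0 ?powR_ge0 //.
rewrite [leRHS]exprMn exprAC.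
apply: (@le_trans _ _ ((D%:R * N%:R ^+ 60) ^+ 4)).
  by rewrite lerXn2r ?nnegrE ?mulr_ge0 ?exprn_ge0.
rewrite exprMn; apply: ler_pM; rewrite ?exprn_ge0 //.
  by rewrite -{1}(expr1 (D%:R ^+ 4)) ler_weXn2l // exprn_ege1.
rewrite -exprM -!powR_mulrn ?powR_ge0 // -powRrM.
by apply: ler_powR => //; apply: le_trans le_eps; rewrite ler_nat.
Qed.

End Real.

Theorem theorem2 (R : realType) (eps : R) (eps_gt0 : 0 < eps) :
  exists2 c : R, 0 < c &
    forall (p : nat) (I : {set 'F_p}) (lambda : 'F_p),
      prime p ->
      is_interval I ->
      0 \notin I ->
      #|I|%:R < p%:R `^ (3%:R / 46%:R) :> R ->
      lambda \notin inverse_set I :|: [set 0] ->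
      (num_solutions I lambda)%:R < c * #|I|%:R `^ (2%:R / 3%:R + eps).
Proof.
pose k := (Num.truncn (240%:R / eps)).+1.
have k_gt0 : (0 < k)%N by [].
have le_k : 240%:R <= eps * k%:R.
  by rewrite mulrC -ler_pdivrMr // ltW // truncnS_gt.
pose D : R := ((2 ^ k * (k ^ k) ^ (2 ^ k))%N%:R) ^+ 4.
have D_ge0 : 0 <= D by rewrite exprn_ge0.
(* [c1] serves when [48 <= m], [c2] bounds the trivial count [N ^ 3] when [N < 48 ^ 3], and the
   additional 1 in the constant makes the inequality strict. *)
pose c1 : R := 2305%:R * 8%:R * D; pose c2 : R := 48%:R ^+ 9.
have c1_ge0 : 0 <= c1 by rewrite !mulr_ge0.
have c2_ge0 : 0 <= c2 by rewrite exprn_ge0.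
exists (c1 + c2 + 1) => [|p I lam p_pr].
  by rewrite ltr_wpDl ?addr_ge0.
move=> [M' [N [/andP [N_gt0 leNp] EI]]] I0 ltN lamI.
(* The interval starts at [M' + 1], whereas [elt] counts indices from 0. *)
pose M : int := M' + 1.
have EM (i : 'I_N) : (M' + i.+1%:Z)%:~R = elt p M i.
  by rewrite /elt /M -addn1 PoszD -addrA [1 + _]addrC.
have mem_elt (i : 'I_N) : elt p M i \in I.
  by rewrite EI; apply/imsetP; exists i.
have cardI : #|I| = N.
  rewrite EI card_imset ?card_ord // => i j; rewrite !EM => /eqP.
  rewrite -subr_eq0 /elt -intrB => /eqP /(intr_Fp_small p_pr) E.
  apply: val_inj => /=; have := ltn_ord i; have := ltn_ord j => hj hi.
  have : (`|(M + (i : nat)%:Z - (M + (j : nat)%:Z))%R| < p)%N.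
    by clear -hi hj leNp; lia.
  by move=> /E; clear; lia.
have elt_neq0 (i : 'I_N) : elt p M i != 0.
  by apply: contraNneq I0 => <-.
move: lamI; rewrite !inE negb_or => /andP [lam_inv lam0].
have lamB (i : 'I_N) : lam - (elt p M i)^-1 != 0.
  by rewrite subr_eq0; apply: contraNneq lam_inv => ->; apply: imset_f.
have J_le : (num_solutions I lam <= #|recip_triples M N lam|)%N.
  pose f (t : 'I_N * 'I_N * 'I_N) := (elt p M t.1.1, elt p M t.1.2, elt p M t.2).
  apply: leq_trans (leq_imset_card f _); apply/subset_leq_card/subsetP.
  move=> [[x y] z]; rewrite inE EI => /and4P [].
  move=> /imsetP [i _ ->] /imsetP [j _ ->] /imsetP [l _ ->] E.
  by apply/imsetP; exists (i, j, l); rewrite ?inE /f /= -?EM.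
have N_ge1 : (1 : R) <= N%:R by rewrite ler1n.
rewrite cardI in ltN *; set E := _ `^ _.
have E_ge1 : 1 <= E.
  by rewrite -(powRr0 N%:R) ler_powR // addr_ge0 ?divr_ge0 // ltW.
suff : (num_solutions I lam)%:R <= c1 * E + c2 * E.
  by move=> /le_lt_trans; apply; rewrite -mulrDl ltr_pM2r ?ltrDl // (lt_le_trans _ E_ge1).
have [m /andP [mN Nm]] := exists_cube_root N.
have [m_ge|m_lt] := leqP 48 m.
  apply: (@le_trans _ _ (c1 * E)); last by rewrite lerDl mulr_ge0 // (le_trans _ E_ge1).
  have ltNp : (N ^ 46 < p ^ 3)%N.
    rewrite -(ltr_nat R) !natrX.
    have -> : p%:R ^+ 3 = (p%:R `^ (3%:R / 46%:R)) ^+ 46 :> R.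
      rewrite -[RHS]powR_mulrn ?powR_ge0 // -powRrM divfK ?pnatr_eq0 //.
      by rewrite powR_mulrn.
    by rewrite ltr_pXn2r ?nnegrE ?powR_ge0.
  have N15 : (N ^ 15 < p)%N.
    rewrite ltnNge; apply/negP => le_p; move: ltNp; rewrite ltnNge => /negP [].
    apply: leq_trans (_ : (N ^ 15) ^ 3 <= _)%N; first by rewrite leq_exp2r.
    by rewrite -expnM leq_pexp2l.
  have N1000 : (1000 <= N)%N.
    apply: leq_trans mN; apply: leq_trans (_ : 10 ^ 3 <= _)%N => //.
    by rewrite leq_exp2r // (leq_trans _ m_ge).
  pose T := max_zdivisors (N ^ 60).
  have T_ge2 : (2 <= T)%N by apply: max_zdivisors_ge2; rewrite expn_gt0 N_gt0.
  have few (z : int) : z != 0 -> (`|z| <= N ^ 60)%N -> (size (zdivisors z) <= T)%N.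
    by move=> _; apply: leq_max_zdivisors.
  have mN' : (m ^ 3 <= N < m.+1 ^ 3)%N by rewrite mN.
  have := card_recip_triples p_pr N1000 N15 elt_neq0 T_ge2 few lam0 lamB m_ge mN' ltNp.
  move/(leq_trans J_le); rewrite -(ler_nat R) => /le_trans; apply.
  have -> : (2305 * 8 * (T ^ 4 * m ^ 2))%:R
      = 2305%:R * 8%:R * (T%:R ^+ 4 * m%:R ^+ 2) :> R by rewrite -!natrX -!natrM.
  rewrite [leRHS](_ : _ = 2305%:R * 8%:R * (D * E)); last by rewrite /c1 [RHS]mulrA.
  rewrite ler_wpM2l ?mulr_ge0 //.
  rewrite [in leRHS]/E powRD; last by rewrite pnatr_eq0 -lt0n N_gt0 implybT.
  rewrite [_ * _ `^ eps]mulrC [leRHS]mulrA; apply: ler_pM; rewrite ?exprn_ge0 //.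
    exact: max_zdivisors_powR.
  (* Thus [m ^ 2 = (m ^ 3) ^ (2 / 3) <= N ^ (2 / 3)]. *)
  have -> : m%:R ^+ 2 = (m%:R ^+ 3) `^ (2%:R / 3%:R) :> R.
    rewrite -[m%:R ^+ 3]powR_mulrn // -powRrM [3%:R * _]mulrC divfK ?pnatr_eq0 //.
    by rewrite powR_mulrn.
  by rewrite ge0_ler_powR ?nnegrE ?exprn_ge0 ?divr_ge0 // -natrX ler_nat.
apply: (@le_trans _ _ c2); last first.
  by rewrite -[leLHS]add0r lerD ?mulr_ge0 ?ler_peMr // (le_trans _ E_ge1).
have : (num_solutions I lam <= (48 ^ 3) ^ 3)%N.
  apply: leq_trans J_le _; apply: leq_trans (max_card _) _.
  rewrite !card_prod card_ord (_ : N * N * N = N ^ 3)%N; last by ring.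
  rewrite leq_exp2r //.
  by apply: ltnW; apply: leq_trans Nm _; rewrite leq_exp2r.
by rewrite -(ler_nat R) /c2 -expnM natrX.
Qed.
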